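(* If $\mathcal{N}$ is a strong $n$-Poincaré–Novikov structure such that each $\mathcal{P}(\mathcal{N})_k$ admits a doubly-orthogonal basis, then there is a bijection from $\bigcup_k\mathcal{B}_k(\mathcal{N})$ to itself which pairs each element $[a,b]^{\Gamma}\in\mathcal{B}_k(\mathcal{N})$ (resp. $(a,b)^{\Gamma}\in\mathcal{B}_k(\mathcal{N})$) such that $a<b$ with an element $(a,b)^{\Gamma}$ (resp. $[a,b]^{\Gamma}$) of $\mathcal{B}_{n-1-k}(\mathcal{N})$, and which pairs any element of the form $[a,a]^{\Gamma}\in\mathcal{B}_k(\mathcal{N})$ with an element $[a,a]^{\Gamma}$ of $\mathcal{B}_{n-k}(\mathcal{N})$. (Here the $\mathcal{B}_k(\mathcal{N})$ are multisets and elements retain their degree $k$ in the union.)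
   Context: Fix a field $\kappa$ and a finitely generated additive subgroup $\Gamma\le\mathbb{R}$. $\Lambda=\kappa[\Gamma]$ (finite sums $\sum_{g\in\Gamma}a_gT^g$). $\Lambda_{\uparrow}$ (resp. $\Lambda^{\downarrow}$) is the field of formal sums $\sum_{g\in\Gamma}a_gT^g$ such that for every $C\in\mathbb{R}$ only finitely many $g$ with $g<C$ (resp. $g>-C$) have $a_g\ne0$. $\nu_{\uparrow}(\sum a_gT^g)=\min\{g: a_g\neq 0\}$ on $\Lambda_{\uparrow}$ ($\nu_\uparrow(0)=+\infty$), $\nu^{\downarrow}(\sum a_gT^g)=\max\{g:a_g\ne0\}$ on $\Lambda^{\downarrow}$ ($\nu^{\downarrow}(0)=-\infty$). Conjugation: $\overline{\sum a_gT^g}=\sum a_gT^{-g}$. For a $\Lambda$-module $M$, ${}^{\vee}M=\mathrm{Hom}_\Lambda(M,\Lambda)$ with $(\lambda\phi)(m)=\bar\lambda\phi(m)$; for a $\Lambda_{\uparrow}$-vector space $V$, ${}^{\vee}V=\mathrm{Hom}_{\Lambda_{\uparrow}}(V,\Lambda_{\uparrow})$ made into a $\Lambda^{\downarrow}$-vector space by $(\mu\zeta)(v)=\bar\mu\zeta(v)$. A normed $\Lambda_{\uparrow}$-space $(V,\rho)$ is a finite-dimensional $\Lambda_{\uparrow}$-vector space with $\rho:V\to\mathbb{R}\cup\{-\infty\}$, $\rho(x)=-\infty$ iff $x=0$, $\rho(\lambda x)=\rho(x)-\nu_{\uparrow}(\lambda)$, $\rho(x+y)\le\max\{\rho(x),\rho(y)\}$.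 A normed $\Lambda^{\downarrow}$-space $(V^{\downarrow},\rho^{\downarrow})$ is a finite-dimensional $\Lambda^{\downarrow}$-vector space with $\rho^{\downarrow}:V^{\downarrow}\to\mathbb{R}\cup\{\infty\}$, $\rho^{\downarrow}(x)=\infty$ iff $x=0$, $\rho^{\downarrow}(\lambda x)=\rho^{\downarrow}(x)-\nu^{\downarrow}(\lambda)$, $\rho^{\downarrow}(x+y)\ge\min\{\rho^{\downarrow}(x),\rho^{\downarrow}(y)\}$. A set $\{x_i\}$ is $\rho_\uparrow$-orthogonal if $\rho_\uparrow(\sum\lambda_ix_i)=\max_i(\rho_\uparrow(x_i)-\nu_{\uparrow}(\lambda_i))$ for all $\lambda_i\in\Lambda_\uparrow$, and $\rho^{\downarrow}$-orthogonal if $\rho^{\downarrow}(\sum\lambda_ix_i)=\min_i(\rho^{\downarrow}(x_i)-\nu^{\downarrow}(\lambda_i))$ for all $\lambda_i\in\Lambda^\downarrow$. For a normed $\Lambda_\uparrow$-space $(V,\rho)$, $({}^{\vee}V,{}^{\vee}\rho)$ is the normed $\Lambda^{\downarrow}$-space with ${}^{\vee}\rho(\zeta)=\inf_{0\ne x\in V}(\nu_{\uparrow}(\zeta(x))+\rho(x))$. A filtered matched pair $\mathcal{P}$ consists of a finitely generated $\Lambda$-module $H$, a normed $\Lambda_{\uparrow}$-space $(V_{\uparrow},\rho_{\uparrow})$, a normed $\Lambda^{\downarrow}$-space $(V^{\downarrow},\rho^{\downarrow})$, and $\Lambda$-homomorphisms $\phi_{\uparrow}:H\to V_{\uparrow}$,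 $\phi^{\downarrow}:H\to V^{\downarrow}$ which become isomorphisms after extending coefficients of $H$ to $\Lambda_{\uparrow}$, resp. $\Lambda^{\downarrow}$. A doubly-orthogonal basis is a subset $\{e_1,\dots,e_d\}\subset H$ projecting to a $\Lambda$-basis of $H/tH$ ($tH$ the torsion submodule) with $\{\phi_{\uparrow}e_i\}$ a $\rho_{\uparrow}$-orthogonal basis of $V_{\uparrow}$ and $\{\phi^{\downarrow}e_i\}$ a $\rho^{\downarrow}$-orthogonal basis of $V^{\downarrow}$. If one exists, the basis spectrum $\Sigma(\mathcal{P})$ is the multiset of pairs $([\rho_{\uparrow}(\phi_{\uparrow}e_i)],\rho^{\downarrow}(\phi^{\downarrow}e_i)-\rho_{\uparrow}(\phi_{\uparrow}e_i))\in(\mathbb{R}/\Gamma)\times\mathbb{R}$ (independent of the basis). A strong $n$-Poincaré–Novikov structure $\mathcal{N}$ ($n\in\mathbb{Z}$) consists of: finitely generated $\Lambda$-modules $H_k$ ($k\in\mathbb{Z}$) and $\Lambda$-homomorphisms $\mathcal{D}_k:H_k\to{}^{\vee}H_{n-k}$ such that $(\mathcal{D}_kx)(y)=\pm\overline{(\mathcal{D}_{n-k}y)(x)}$ for all $x\in H_k,y\in H_{n-k}$ (for some sign that may depend on $k$) and each $\mathcal{D}_k$ is surjective with kernel equal to the $\Lambda$-torsion submodule of $H_k$; normed $\Lambda_{\uparrow}$-spaces $(V_k,\rho_k)$; and $\Lambda$-homomorphisms $S_k:H_k\to V_k$ such that $1\otimes S_k:\Lambda_{\uparrow}\otimes_\Lambda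 H_k\to V_k$ is an isomorphism. It yields filtered matched pairs $\mathcal{P}(\mathcal{N})_k$ with module $H_k$, $\phi_{\uparrow}=S_k:H_k\to(V_k,\rho_k)$, and $\phi^{\downarrow}=\widetilde S_k:H_k\to({}^{\vee}V_{n-k},{}^{\vee}\rho_{n-k})$, where $\widetilde S_k$ is characterized by $(\widetilde S_kx)(S_{n-k}y)=(\mathcal{D}_kx)(y)$ for all $x\in H_k$, $y\in H_{n-k}$. For an interval $I\subset\mathbb{R}$, $I^\Gamma$ denotes its equivalence class under translation by elements of $\Gamma$. $\mathcal{B}_k(\mathcal{N})$ is the multiset consisting of $[a,a+\ell]^{\Gamma}$ for each $([a],\ell)\in\Sigma(\mathcal{P}(\mathcal{N})_k)$ with $\ell\ge0$ together with $(a+\ell,a)^{\Gamma}$ for each $([a],\ell)\in\Sigma(\mathcal{P}(\mathcal{N})_{k+1})$ with $\ell<0$. *)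

(* Defs.v *)
From HB Require Import structures.
From mathcomp Require Import all_boot all_order all_algebra.
From mathcomp Require Import ring_quotient.
From mathcomp Require Import all_classical all_reals ereal.

Set Implicit Arguments.
Unset Strict Implicit.
Unset Printing Implicit Defensive.

Import Order.TTheory GRing.Theory Num.Theory.

Local Open Scope classical_set_scope.
Local Open Scope ring_scope.
Local Open Scope quotient_scope.

(* A family of subsets of R, playing the role of the admissible supports of   *)
(* formal sums, for which such sums form a ring under convolution.            *)
Record suppfam (R : realType) := Suppfam {
  sf :> set R -> Prop;
  sf_1 : sf [set 0];
  sf_S : forall A B : set R, A `<=` B -> sf B -> sf A;
  sf_U : forall A B : set R, sf A -> sf B -> sf (A `|` B);
  sf_D : forall A B : set R, sf A -> sf B -> sf [set a + b | a in A & b in B];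
  sf_fin : forall (A B : set R) (x : R), sf A -> sf B ->
    finite_set [set y | A y /\ B (x - y)] }.

(* Formal sums \sum_g a_g T^g whose support {g | a_g != 0} is admissible.     *)
Record series (F : fieldType) (R : realType) (S : suppfam R) := Series {
  coef :> R -> F;
  coef_supp : S [set g | coef g != 0] }.

Section SeriesRing.
Variables (F : fieldType) (R : realType) (S : suppfam R).
Notation T := (series F S).
Implicit Types f g h : T.

HB.instance Definition _ := gen_eqMixin T.
HB.instance Definition _ := gen_choiceMixin T.

Lemma seriesP f g : (forall x, f x = g x) -> f = g.
Proof.
case: f g => [f fS] [g gS] /= /funext fg; subst g.
by congr Series; exact: Prop_irrelevance.
Qed.

Lemma sf_0 : S set0.
Proof. by apply: (sf_S _ (sf_1 S)) => x. Qed.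

Fact zero_supp : S [set g | (fun=> 0 : F) g != 0].
Proof. by apply: sf_S sf_0 => x /=; rewrite eqxx. Qed.
Definition szero : T := Series zero_supp.

Fact one_supp : S [set g | (fun x : R => (x == 0)%:R : F) g != 0].
Proof.
apply: sf_S (sf_1 S) => x /=; case: (x =P 0) => [->//|_].
by rewrite eqxx.
Qed.
Definition sone : T := Series one_supp.

Fact add_supp f g : S [set x | (fun x => f x + g x) x != 0].
Proof.
apply: sf_S (sf_U (coef_supp f) (coef_supp g)) => x /=.
by case: (f x =P 0) => [->|_ _]; [rewrite add0r; right|left].
Qed.
Definition sadd f g : T := Series (add_supp f g).

Fact opp_supp f : S [set x | (fun x => - f x) x != 0].
Proof. by apply: sf_S (coef_supp f) => x /=; rewrite oppr_eq0. Qed.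
Definition sopp f : T := Series (opp_supp f).

Definition conv f g (x : R) : F := \sum_(y \in setT) f y * g (x - y).

Lemma convE f g x (A : set R) : finite_set A ->
  (forall y, f y * g (x - y) != 0 -> A y) ->
  conv f g x = \sum_(y \in A) f y * g (x - y).
Proof.
move=> finA supp; apply/esym/fsbig_widen => // y [_ /= nA].
by apply/eqP/negP => /negP /supp.
Qed.

Lemma conv_neq0 f g x : conv f g x != 0 -> exists y, f y != 0 /\ g (x - y) != 0.
Proof.
move=> cn0; apply: contrapT => no; move/eqP: cn0; apply.
apply: fsbig1 => y _; apply/eqP/negP => /negP.
by rewrite mulf_eq0 negb_or => /andP[fy gy]; apply: no; exists y.
Qed.

Fact mul_supp f g : S [set x | conv f g x != 0].
Proof.
apply: sf_S (sf_D (coef_supp f) (coef_supp g)) => x /= /conv_neq0[y [fy gy]].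
by exists y => //; exists (x - y) => //; rewrite addrCA subrr addr0.
Qed.
Definition smul f g : T := Series (mul_supp f g).

Lemma saddA : associative sadd.
Proof. by move=> f g h; apply: seriesP => x /=; rewrite addrA. Qed.
Lemma saddC : commutative sadd.
Proof. by move=> f g; apply: seriesP => x /=; rewrite addrC. Qed.
Lemma sadd0 : left_id szero sadd.
Proof. by move=> f; apply: seriesP => x /=; rewrite add0r. Qed.
Lemma saddN : left_inverse szero sopp sadd.
Proof. by move=> f; apply: seriesP => x /=; rewrite addNr. Qed.
HB.instance Definition _ := GRing.isZmodule.Build T saddA saddC sadd0 saddN.

Lemma smulC : commutative smul.
Proof.
move=> f g; apply: seriesP => x /=; rewrite /conv.
rewrite (reindex_fsbigT (fun y => x - y)) /=; last first.
  by exists (fun y => x - y) => y; rewrite subKr.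
by apply: eq_fsbigr => y _; rewrite subKr mulrC.
Qed.

Lemma smul1 : left_id sone smul.
Proof.
move=> f; apply: seriesP => x /=; rewrite (@convE _ _ _ [set 0]) //=.
  by rewrite fsbig_set1 /= eqxx mul1r subr0.
by move=> y; case: (y =P 0) => [->//|_]; rewrite /= mul0r eqxx.
Qed.

Lemma smulDl : left_distributive smul sadd.
Proof.
move=> f g h; apply: seriesP => x /=.
pose A := [set y | (f y != 0 \/ g y != 0) /\ h (x - y) != 0].
have finA : finite_set A.
  apply: sub_finite_set
    (sf_fin x (sf_U (coef_supp f) (coef_supp g)) (coef_supp h)).
  by move=> y [].
rewrite !(@convE _ _ _ A) //=.
- rewrite -fsbig_split //=; apply: eq_fsbigr => y _; exact: mulrDl.
- by move=> y; rewrite mulf_eq0 negb_or => /andP[? ?]; split=> //; right.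
- by move=> y; rewrite mulf_eq0 negb_or => /andP[? ?]; split=> //; left.
- move=> y; rewrite mulf_eq0 negb_or => /andP[fg hy]; split=> //.
  by case: (f y =P 0) fg => [->|_ _]; [rewrite add0r; right|left].
Qed.

Lemma smulA : associative smul.
Proof.
move=> f g h; apply: seriesP => x /=.
have pf := coef_supp f; have pg := coef_supp g; have ph := coef_supp h.
pose Y := [set y | f y != 0 /\
   [set a + b | a in [set u | g u != 0] & b in [set u | h u != 0]] (x - y)].
pose W := [set w |
   [set a + b | a in [set u | f u != 0] & b in [set u | g u != 0]] w /\
   h (x - w) != 0].
have finY : finite_set Y by apply: sf_fin pf (sf_D pg ph).
have finW : finite_set W by apply: sf_fin (sf_D pf pg) ph.
have nz2 (a b : F) : a * b != 0 -> a != 0 /\ b != 0.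
  by rewrite mulf_eq0 negb_or => /andP.
rewrite (@convE f (smul g h) x Y) //; last first.
  move=> y /nz2[fy /conv_neq0 [z [gz hz]]]; split => //.
  by exists z => //; exists (x - y - z) => //; rewrite addrCA subrr addr0.
rewrite (@convE (smul f g) h x W) //; last first.
  move=> w /nz2[/conv_neq0 [z [fz gz]] hw]; split => //.
  by exists z => //; exists (w - z) => //; rewrite addrCA subrr addr0.
transitivity (\sum_(y \in Y) \sum_(w \in W) f y * (g (w - y) * h (x - w))).
  apply: eq_fsbigr => y; rewrite inE => -[fy _] /=.
  rewrite -mulr_fsumr; congr (_ * _); rewrite /conv.
  rewrite (reindex_fsbigT (fun w => w - y)) /=; last first.
    by exists (fun w => w + y) => w; rewrite ?subrK ?addrK.
  apply/esym; transitivity (\sum_(w \in W) g (w - y) * h (x - y - (w - y))).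
    by apply: eq_fsbigr => w _; rewrite opprB addrA subrK.
  apply: fsbig_widen => // w [_ /= nW].
  rewrite opprB addrA subrK.
  apply/eqP/negP => /negP /nz2[gw hw]; apply: nW; split => //.
  by exists y => //; exists (w - y) => //; rewrite addrCA subrr addr0.
rewrite exchange_fsbig //; apply: eq_fsbigr => w; rewrite inE => -[_ hw] /=.
rewrite (@convE f g w Y) //; last first.
  move=> y /nz2[fy gy]; split => //; exists (w - y) => //.
  by exists (x - w) => //; rewrite addrC addrA subrK.
rewrite mulr_fsuml; apply: eq_fsbigr => y _; exact: mulrA.
Qed.

Lemma sone_neq0 : sone != szero.
Proof.
apply/eqP => /(congr1 (fun f : T => f 0)) /= /eqP.
by rewrite eqxx oner_eq0.
Qed.

HB.instance Definition _ := GRing.Zmodule_isComNzRing.Build T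
  smulA smulC smul1 smulDl sone_neq0.

Lemma scoef0 x : (0 : T) x = 0. Proof. by []. Qed.
Lemma scoefD f g x : (f + g) x = f x + g x. Proof. by []. Qed.
Lemma scoefN f x : (- f) x = - f x. Proof. by []. Qed.
Lemma scoef1 x : (1 : T) x = (x == 0)%:R. Proof. by []. Qed.
Lemma scoefM f g x : (f * g) x = \sum_(y \in setT) f y * g (x - y).
Proof. by []. Qed.

End SeriesRing.

Section Supports.
Variables (R : realType) (Gam : zmodClosed R).
Implicit Types A B : set R.

Definition fin_supp A := A `<=` [set` Gam] /\ finite_set A.
Definition up_supp A :=
  A `<=` [set` Gam] /\ forall C : R, finite_set (A `&` [set g | g < C]).
Definition down_supp A :=
  A `<=` [set` Gam] /\ forall C : R, finite_set (A `&` [set g | g > - C]).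

Let subG_D A B : A `<=` [set` Gam] -> B `<=` [set` Gam] ->
  [set a + b | a in A & b in B] `<=` [set` Gam].
Proof.
move=> AG BG _ [a Aa [b Bb <-]] /=.
by apply: rpredD; [exact: AG|exact: BG].
Qed.

Let sub1G : [set 0] `<=` [set` Gam].
Proof. by move=> x ->; exact: rpred0. Qed.

Fact fin_sf1 : fin_supp [set 0].
Proof. by split. Qed.
Fact fin_sfS A B : A `<=` B -> fin_supp B -> fin_supp A.
Proof.
by move=> AB [BG finB]; split; [exact: subset_trans BG|exact: sub_finite_set finB].
Qed.
Fact fin_sfU A B : fin_supp A -> fin_supp B -> fin_supp (A `|` B).
Proof.
by move=> [AG fA] [BG fB]; split; [rewrite subUset|rewrite finite_setU].
Qed.
Fact fin_sfD A B : fin_supp A -> fin_supp B ->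
  fin_supp [set a + b | a in A & b in B].
Proof.
by move=> [AG fA] [BG fB]; split; [exact: subG_D|exact: finite_image2].
Qed.
Fact fin_sffin A B (x : R) : fin_supp A -> fin_supp B ->
  finite_set [set y | A y /\ B (x - y)].
Proof. by move=> [_ fA] _; apply: sub_finite_set fA => y []. Qed.
Definition fin_fam : suppfam R := Suppfam fin_sf1 fin_sfS fin_sfU fin_sfD fin_sffin.

Lemma finite_lbound A : finite_set A -> exists m, forall a, A a -> m <= a.
Proof.
move=> /finite_seqP[s ->]; elim: s => [|x s [m mP]]; first by exists 0.
exists (Num.min x m) => a /=; rewrite inE => /orP[/eqP->|/mP].
  by rewrite ge_min lexx.
by rewrite ge_min orbC => ->.
Qed.

Lemma up_lbound A : up_supp A -> exists m, forall a, A a -> m <= a.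
Proof.
move=> [_ /(_ 0) /finite_lbound[m mP]]; exists (Num.min m 0) => a Aa.
rewrite ge_min; case: (ltP a 0) => [a0|_]; last by rewrite orbT.
by rewrite mP.
Qed.

Fact up_sf1 : up_supp [set 0].
Proof. by split => // C; apply: finite_setIl. Qed.
Fact up_sfS A B : A `<=` B -> up_supp B -> up_supp A.
Proof.
move=> AB [BG fB]; split; first exact: subset_trans BG.
by move=> C; apply: sub_finite_set (fB C); exact: setSI.
Qed.
Fact up_sfU A B : up_supp A -> up_supp B -> up_supp (A `|` B).
Proof.
move=> [AG fA] [BG fB]; split; first by rewrite subUset.
by move=> C; rewrite setIUl finite_setU.
Qed.
Fact up_sfD A B : up_supp A -> up_supp B ->
  up_supp [set a + b | a in A & b in B].
Proof.
move=> uA uB; have [[AG fA] [BG fB]] := (uA, uB).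
have [mA mAP] := up_lbound uA; have [mB mBP] := up_lbound uB.
split; first exact: subG_D.
move=> C; apply: sub_finite_set
  (finite_image2 (fun a b => a + b) (fA (C - mB)) (fB (C - mA))).
move=> _ [[a Aa [b Bb <-]] /= abC]; exists a.
  split => //=; rewrite ltrBrDr; apply: le_lt_trans abC.
  by rewrite lerD2l mBP.
exists b => //; split => //=; rewrite ltrBrDl; apply: le_lt_trans abC.
by rewrite lerD2r mAP.
Qed.
Fact up_sffin A B (x : R) : up_supp A -> up_supp B ->
  finite_set [set y | A y /\ B (x - y)].
Proof.
move=> [_ fA] /up_lbound[m mP]; apply: sub_finite_set (fA (x - m + 1)).
move=> y [Ay /mP mxy]; split => //=.
by rewrite ltr_pwDr // lerBrDl -lerBrDr.
Qed.
Definition up_fam : suppfam R := Suppfam up_sf1 up_sfS up_sfU up_sfD up_sffin.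

Lemma subG_N A : A `<=` [set` Gam] -> [set x | A (- x)] `<=` [set` Gam].
Proof. by move=> AG x /AG /=; rewrite rpredN. Qed.

Lemma finite_N A : finite_set A -> finite_set [set x | A (- x)].
Proof.
move=> fA; apply: sub_finite_set (finite_image -%R fA) => x Ax.
by exists (- x) => //; rewrite opprK.
Qed.

Lemma N_up A : up_supp A -> down_supp [set x | A (- x)].
Proof.
move=> [AG fA]; split; first exact: subG_N.
move=> C; apply: sub_finite_set (finite_N (fA C)) => x /= [Ax Cx].
by split => //=; rewrite ltrNl.
Qed.
Lemma N_down A : down_supp A -> up_supp [set x | A (- x)].
Proof.
move=> [AG fA]; split; first exact: subG_N.
move=> C; apply: sub_finite_set (finite_N (fA C)) => x /= [Ax Cx].
by split => //=; rewrite ltrN2.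
Qed.
Lemma N_fin A : fin_supp A -> fin_supp [set x | A (- x)].
Proof. by move=> [AG fA]; split; [exact: subG_N|exact: finite_N]. Qed.

Let N_N A : [set x | [set y | A (- y)] (- x)] = A.
Proof. by apply/seteqP; split => x /=; rewrite opprK. Qed.

Fact down_sf1 : down_supp [set 0].
Proof. by split => // C; apply: finite_setIl. Qed.
Fact down_sfS A B : A `<=` B -> down_supp B -> down_supp A.
Proof.
move=> AB [BG fB]; split; first exact: subset_trans BG.
by move=> C; apply: sub_finite_set (fB C); exact: setSI.
Qed.
Fact down_sfU A B : down_supp A -> down_supp B -> down_supp (A `|` B).
Proof.
move=> [AG fA] [BG fB]; split; first by rewrite subUset.
by move=> C; rewrite setIUl finite_setU.
Qed.
Fact down_sfD A B : down_supp A -> down_supp B ->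
  down_supp [set a + b | a in A & b in B].
Proof.
move=> /N_down uA /N_down uB; move/N_up: (up_sfD uA uB); apply: down_sfS.
move=> _ [a Aa [b Bb <-]] /=; exists (- a); rewrite /= ?opprK //.
by exists (- b); rewrite /= ?opprK // opprD.
Qed.
Fact down_sffin A B (x : R) : down_supp A -> down_supp B ->
  finite_set [set y | A y /\ B (x - y)].
Proof.
move=> /N_down uA /N_down uB; have /finite_N := up_sffin (- x) uA uB.
apply: sub_finite_set => y /= [Ay Bxy]; rewrite opprK; split => //.
by rewrite opprD opprK.
Qed.
Definition down_fam : suppfam R :=
  Suppfam down_sf1 down_sfS down_sfU down_sfD down_sffin.

Lemma fin_up A : fin_supp A -> up_supp A.
Proof. by move=> [AG fA]; split => // C; apply: finite_setIl. Qed.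
Lemma fin_down A : fin_supp A -> down_supp A.
Proof. by move=> [AG fA]; split => // C; apply: finite_setIl. Qed.

End Supports.

(* The rings kappa[Gam], Lambda_up and Lambda^down: formal sums supported in   *)
(* Gam with finite support, resp. with finitely many exponents below, resp.   *)
(* above, any given real.                                                     *)
Definition Lam (F : fieldType) (R : realType) (Gam : zmodClosed R) :=
  series F (fin_fam Gam).
Definition Lam_up (F : fieldType) (R : realType) (Gam : zmodClosed R) :=
  series F (up_fam Gam).
Definition Lam_down (F : fieldType) (R : realType) (Gam : zmodClosed R) :=
  series F (down_fam Gam).

HB.instance Definition _ (F : fieldType) (R : realType) (Gam : zmodClosed R) :=
  GRing.ComNzRing.on (Lam F Gam).
HB.instance Definition _ (F : fieldType) (R : realType) (Gam : zmodClosed R) :=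
  GRing.ComNzRing.on (Lam_up F Gam).
HB.instance Definition _ (F : fieldType) (R : realType) (Gam : zmodClosed R) :=
  GRing.ComNzRing.on (Lam_down F Gam).

Section SeriesMaps.
Variables (F : fieldType) (R : realType) (S S' : suppfam R).

Section Inclusion.
Hypothesis SS' : forall A, S A -> S' A.
Definition sincl (f : series F S) : series F S' :=
  Series (SS' (coef_supp f)).

Fact sincl_zmod : zmod_morphism sincl.
Proof. by move=> f g; exact: seriesP. Qed.
Fact sincl_monoid : monoid_morphism sincl.
Proof. by split=> [|f g]; exact: seriesP. Qed.
End Inclusion.

Section Conjugation.
Hypothesis SS' : forall A, S A -> S' [set x | A (- x)].
Definition sconj (f : series F S) : series F S' :=
  @Series F R S' (fun x => f (- x)) (SS' (coef_supp f)).

Fact sconj_zmod : zmod_morphism sconj.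
Proof. by move=> f g; exact: seriesP. Qed.
Fact sconj_monoid : monoid_morphism sconj.
Proof.
split=> [|f g]; apply: seriesP => x /=; first by rewrite oppr_eq0.
rewrite /conv (reindex_fsbigT -%R) /=; last by exists -%R => y; rewrite opprK.
by apply: eq_fsbigr => y _; rewrite opprK opprD opprK.
Qed.
End Conjugation.
End SeriesMaps.

Section LamMaps.
Variables (F : fieldType) (R : realType) (Gam : zmodClosed R).

Definition to_up : Lam F Gam -> Lam_up F Gam := @sincl F R (fin_fam Gam) (up_fam Gam) (@fin_up R Gam).
HB.instance Definition _ := GRing.isZmodMorphism.Build _ _ to_up
  (@sincl_zmod F R (fin_fam Gam) (up_fam Gam) (@fin_up R Gam)).
HB.instance Definition _ := GRing.isMonoidMorphism.Build _ _ to_up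
  (@sincl_monoid F R (fin_fam Gam) (up_fam Gam) (@fin_up R Gam)).

Definition to_down : Lam F Gam -> Lam_down F Gam := @sincl F R (fin_fam Gam) (down_fam Gam) (@fin_down R Gam).
HB.instance Definition _ := GRing.isZmodMorphism.Build _ _ to_down
  (@sincl_zmod F R (fin_fam Gam) (down_fam Gam) (@fin_down R Gam)).
HB.instance Definition _ := GRing.isMonoidMorphism.Build _ _ to_down
  (@sincl_monoid F R (fin_fam Gam) (down_fam Gam) (@fin_down R Gam)).

Definition conjL : Lam F Gam -> Lam F Gam := @sconj F R (fin_fam Gam) (fin_fam Gam) (@N_fin R Gam).
HB.instance Definition _ := GRing.isZmodMorphism.Build _ _ conjL
  (@sconj_zmod F R (fin_fam Gam) (fin_fam Gam) (@N_fin R Gam)).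
HB.instance Definition _ := GRing.isMonoidMorphism.Build _ _ conjL
  (@sconj_monoid F R (fin_fam Gam) (fin_fam Gam) (@N_fin R Gam)).

Definition conj_down : Lam_down F Gam -> Lam_up F Gam := @sconj F R (down_fam Gam) (up_fam Gam) (@N_down R Gam).
HB.instance Definition _ := GRing.isZmodMorphism.Build _ _ conj_down
  (@sconj_zmod F R (down_fam Gam) (up_fam Gam) (@N_down R Gam)).
HB.instance Definition _ := GRing.isMonoidMorphism.Build _ _ conj_down
  (@sconj_monoid F R (down_fam Gam) (up_fam Gam) (@N_down R Gam)).

Definition conj_up : Lam_up F Gam -> Lam_down F Gam := @sconj F R (up_fam Gam) (down_fam Gam) (@N_up R Gam).

Lemma conj_downK : cancel conj_down conj_up.
Proof. by move=> f; apply: seriesP => x /=; rewrite opprK. Qed.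
Lemma conj_upK : cancel conj_up conj_down.
Proof. by move=> f; apply: seriesP => x /=; rewrite opprK. Qed.
Lemma conj_to_down (a : Lam F Gam) : conj_down (to_down a) = to_up (conjL a).
Proof. exact: seriesP. Qed.

End LamMaps.

Section NovikovField.
Variables (F : fieldType) (R : realType) (Gam : zmodClosed R).
Notation U := (Lam_up F Gam).
Implicit Types f g u : U.

Lemma finite_min (A : set R) x : finite_set A -> A x ->
  exists2 m, A m & forall a, A a -> m <= a.
Proof.
move=> /finite_seqP[s ->]; elim: s x => [|y s IH] x //= _.
case: s IH => [|z s] IH.
  by exists y => [|a] /=; rewrite ?mem_head // inE => /eqP->.
have [|m ms mP] := IH z; first exact: mem_head.
have [ym|my] := leP y m.
  exists y; rewrite /= ?mem_head // => a; rewrite inE => /orP[/eqP->//|/mP].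
  exact: le_trans.
exists m; first by rewrite /= inE; apply/orP; right.
by move=> a; rewrite /= inE => /orP[/eqP->|/mP //]; exact: ltW.
Qed.

Lemma up_min (A : set R) x : up_supp Gam A -> A x ->
  exists2 m, A m & forall a, A a -> m <= a.
Proof.
move=> [_ fA] Ax; have [|m [Am _] mP] := @finite_min _ x (fA (x + 1)).
  by split => //=; rewrite ltrDl.
exists m => // a Aa; have [ax|] := ltP a (x + 1); first by apply: mP.
by apply: le_trans; apply: le_trans (mP x _) _; rewrite ?lerDl //; split => //=; rewrite ltrDl.
Qed.

Lemma series_neq0 (S : suppfam R) (f : series F S) :
  f != 0 -> exists x, f x != 0.
Proof.
move=> f0; apply: contrapT => no; move/eqP: f0; apply; apply: seriesP => x.
by apply/eqP/negP => /negP fx; apply: no; exists x.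
Qed.

Lemma coef_sum (S : suppfam R) n (f : 'I_n -> series F S) x :
  (\sum_(i < n) f i) x = \sum_(i < n) f i x.
Proof.
by apply: (big_ind2 (fun (g : series F S) a => g x = a)) => //= g a h b <- <-.
Qed.

Fact mono_supp (g : R) (c : F) : g \in Gam ->
  up_supp Gam [set x | (fun x => if x == g then c else 0) x != 0].
Proof.
move=> gG; apply: (@up_sfS _ _ _ [set g]).
  by move=> x /=; case: (x =P g) => // _; rewrite eqxx.
by split => [x ->//|C]; apply: finite_setIl.
Qed.

Lemma up_geom_inverse u d : 0 < d -> (forall x, u x != 0 -> d <= x) ->
  exists g, (1 - u) * g = 1.
Proof.
move=> d0 ud.
have uX n x : (u ^+ n) x != 0 -> d *+ n <= x.
  elim: n x => [|n IH] x.
    rewrite expr0 mulr0n scoef1; case: (x =P 0) => [->//|_].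
    by rewrite eqxx.
  rewrite exprS mulrS => /conv_neq0[y [/ud dy /IH nd]].
  by rewrite -(subrK y x) addrC lerD.
have uX0 n x : x < d *+ n -> (u ^+ n) x = 0.
  by move=> xn; apply/eqP/negP => /negP /uX; rewrite leNgt xn.
pose N x := (Num.truncn (x / d)).+1.
have NP x : x < d *+ N x.
  by rewrite -mulr_natr mulrC -ltr_pdivrMr // truncnS_gt.
pose G x := (\sum_(i < N x) u ^+ i) x.
have sumE m x : x < d *+ m -> forall k, (\sum_(i < m + k) u ^+ i) x =
    (\sum_(i < m) u ^+ i) x.
  move=> xm; elim=> [|k IH]; first by rewrite addn0.
  rewrite addnS big_ord_recr /= IH uX0 ?addr0 //.
  by apply: lt_le_trans xm _; rewrite (ler_pMn2l d0) leq_addr.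
have GE m x : x < d *+ m -> G x = (\sum_(i < m) u ^+ i) x.
  move=> xm; rewrite /G; have [le|/ltnW le] := leqP (N x) m.
    by rewrite -(subnKC le) sumE.
  by rewrite -(subnKC le) sumE.
have Gsupp : up_supp Gam [set x | G x != 0].
  split => [x /= Gx|C].
    by case: (coef_supp (\sum_(i < N x) u ^+ i)) => sG _; exact: sG.
  case: (coef_supp (\sum_(i < N C) u ^+ i)) => _ /(_ C).
  apply: sub_finite_set => x [/= Gx xC]; split => //=.
  by rewrite -GE // (lt_trans xC).
exists (@Series F R (up_fam Gam) G Gsupp : U); apply: seriesP => x.
transitivity (((1 - u) * (\sum_(i < N x) u ^+ i)) x).
  rewrite !scoefM; apply: eq_fsbigr => y _.
  case: (@eqP _ ((1 - u) y) 0) => [->|/eqP uy]; first by rewrite !mul0r.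
  congr (_ * _); apply: GE; apply: le_lt_trans (NP x).
  rewrite gerBl; move: uy; rewrite scoefD scoefN scoef1.
  have [->//|/eqP y0] := y =P 0; rewrite sub0r oppr_eq0 => /ud.
  by apply: le_trans; exact: ltW.
have -> : (1 - u) * \sum_(i < N x) u ^+ i = 1 - u ^+ N x.
  by rewrite -opprB mulNr -subrX1 opprB.
by rewrite scoefD scoefN uX0 // subr0.
Qed.

Lemma up_inverse f : f != 0 -> exists g, g * f = 1.
Proof.
move=> /series_neq0[x fx].
have [m fm mP] := up_min (coef_supp f) fx.
have mG : - m \in Gam by rewrite rpredN; case: (coef_supp f) => sG _; exact: sG.
pose t : U := @Series F R (up_fam Gam) _ (mono_supp (f m)^-1 mG).
have tE y : (t * f) y = (f m)^-1 * f (y + m).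
  rewrite -[LHS]/(conv t f y) (@convE _ _ _ _ _ _ [set - m]) //.
    by rewrite fsbig_set1 /= eqxx opprK.
  by move=> z /=; case: (z =P - m) => // _; rewrite mul0r eqxx.
have [g gP] : exists g, (1 - (1 - t * f)) * g = 1.
  pose u := 1 - t * f.
  have u_gt0 y : u y != 0 -> 0 < y.
    rewrite scoefD scoefN scoef1 tE; have [y0|y0|->] := ltgtP y 0 => //.
      rewrite sub0r oppr_eq0 mulf_eq0 negb_or => /andP[_ /mP].
      by rewrite -subr_ge0 addrK leNgt y0.
    by rewrite add0r mulVf // subrr eqxx.
  have [u0|/series_neq0[z uz]] := eqVneq u 0.
    by apply: (@up_geom_inverse _ 1) => // y; rewrite -/u u0 scoef0 eqxx.
  have [d ud dP] := up_min (coef_supp u) uz.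
  by apply: (@up_geom_inverse _ d) => //; exact: u_gt0.
by exists (t * g); rewrite mulrAC -gP opprB addrC subrK.
Qed.

Definition up_inv f : U := if f == 0 then 0 else xget 0 [set g | g * f = 1].
Fact up_mulVf f : f != 0 -> up_inv f * f = 1.
Proof.
move=> f0; rewrite /up_inv (negbTE f0).
by have [g gf] := up_inverse f0; apply: (xgetPex 0 (P := [set g | g * f = 1])); exists g.
Qed.
Fact up_inv0 : up_inv 0 = 0. Proof. by rewrite /up_inv eqxx. Qed.
HB.instance Definition _ := GRing.ComNzRing_isField.Build U up_mulVf up_inv0.

Notation D := (Lam_down F Gam).
Definition down_inv (f : D) : D := conj_up (conj_down f)^-1.
Fact down_mulVf (f : D) : f != 0 -> down_inv f * f = 1.
Proof.
move=> f0; apply: (can_inj (@conj_downK F R Gam)).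
rewrite rmorphM rmorph1 /= /down_inv conj_upK mulVf //.
apply/eqP => cf0; move/eqP: f0; apply; apply: seriesP => x.
by have := congr1 (fun h : U => h (- x)) cf0; rewrite /= opprK.
Qed.
Fact down_inv0 : down_inv 0 = 0.
Proof. by rewrite /down_inv rmorph0 invr0; apply: seriesP. Qed.
HB.instance Definition _ := GRing.ComNzRing_isField.Build D down_mulVf down_inv0.

Lemma to_up_eq0 (a : Lam F Gam) : (to_up a == 0) = (a == 0).
Proof.
apply/eqP/eqP => [a0|->]; last exact: rmorph0.
by apply: seriesP => x; have := congr1 (fun h : U => h x) a0.
Qed.

Lemma Lam_mulf_eq0 (a b : Lam F Gam) : (a * b == 0) = (a == 0) || (b == 0).
Proof. by rewrite -!to_up_eq0 rmorphM mulf_eq0. Qed.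

End NovikovField.

Section Modules.
Variables (A : nzRingType) (M : lmodType A).

Definition lincomb (s : seq M) (c : 'I_(size s) -> A) : M :=
  \sum_(i < size s) c i *: s`_i.

Definition fin_gen : Prop :=
  exists s : seq M, forall x : M, exists c, x = @lincomb s c.

Definition is_basis (s : seq M) : Prop :=
  forall x : M, exists! c : {ffun 'I_(size s) -> A}, x = lincomb c.

End Modules.

(* Extension of scalars B (x)_A M along a ring morphism i : A -> B: the free  *)
(* commutative monoid on B * M, i.e. formal sums of pairs (b, m) given as     *)
(* lists, modulo the congruence generated by the tensor relations.            *)
Section Tensor.
Variables (A B : comNzRingType) (i : {rmorphism A -> B}) (M : lmodType A).

Inductive tens_rel : seq (B * M) -> seq (B * M) -> Prop :=
| tens_refl s : tens_rel s s
| tens_sym s t : tens_rel s t -> tens_rel t s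
| tens_trans s t u : tens_rel s t -> tens_rel t u -> tens_rel s u
| tens_cat s s' t t' :
    tens_rel s s' -> tens_rel t t' -> tens_rel (s ++ t) (s' ++ t')
| tens_catC s t : tens_rel (s ++ t) (t ++ s)
| tens_0l m : tens_rel [:: (0, m)] [::]
| tens_Dl b b' m : tens_rel [:: (b + b', m)] [:: (b, m); (b', m)]
| tens_Dr b m m' : tens_rel [:: (b, m + m')] [:: (b, m); (b, m')]
| tens_Z b a m : tens_rel [:: (b * i a, m)] [:: (b, a *: m)].

Definition tens_eqv : rel (seq (B * M)) := fun s t => `[< tens_rel s t >].

Fact tens_eqv_refl : reflexive tens_eqv.
Proof. by move=> s; apply/asboolP; exact: tens_refl. Qed.
Fact tens_eqv_sym : symmetric tens_eqv.
Proof. by move=> s t; apply/asboolP/asboolP; exact: tens_sym. Qed.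
Fact tens_eqv_trans : transitive tens_eqv.
Proof.
by move=> t s u /asboolP st /asboolP tu; apply/asboolP; exact: tens_trans tu.
Qed.
Canonical tens_equiv := EquivRel tens_eqv
  tens_eqv_refl tens_eqv_sym tens_eqv_trans.

Definition tensor := {eq_quot tens_equiv}.
HB.instance Definition _ := Choice.on tensor.
HB.instance Definition _ := EqQuotient.on tensor.

Lemma tens_pi s t : tens_rel s t <-> \pi_tensor s = \pi_tensor t.
Proof.
split=> [st|/eqmodP/asboolP//].
by apply/eqmodP/asboolP.
Qed.

Let rep (x : tensor) : seq (B * M) := repr x.
Let repK s : tens_rel (rep (\pi_tensor s)) s.
Proof. by apply/tens_pi; rewrite reprK. Qed.
Let tens_ind (P : tensor -> Prop) : (forall s, P (\pi_tensor s)) -> forall x, P x.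
Proof. by move=> H x; rewrite -[x]reprK. Qed.

Let tens_ACA s t u v :
  tens_rel ((s ++ t) ++ (u ++ v)) ((s ++ u) ++ (t ++ v)).
Proof.
rewrite -!catA; apply: tens_cat; first exact: tens_refl.
by rewrite !catA; apply: tens_cat; [exact: tens_catC|exact: tens_refl].
Qed.

Definition tzero : tensor := \pi_tensor [::].
Definition tadd (x y : tensor) : tensor := \pi_tensor (repr x ++ repr y).
Definition tscale (b : B) (x : tensor) : tensor :=
  \pi_tensor [seq (b * p.1, p.2) | p <- repr x].
Definition topp : tensor -> tensor := tscale (-1).

Lemma pi_tadd s t : tadd (\pi_tensor s) (\pi_tensor t) = \pi_tensor (s ++ t).
Proof. by apply/tens_pi; apply: tens_cat; exact: repK. Qed.

Lemma tens_rel_scale b s t : tens_rel s t ->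
  tens_rel [seq (b * p.1, p.2) | p <- s] [seq (b * p.1, p.2) | p <- t].
Proof.
elim=> {s t} /=.
- by move=> s; exact: tens_refl.
- by move=> s t _; exact: tens_sym.
- by move=> s t u _ + _; exact: tens_trans.
- by move=> s s' t t' _ IH1 _ IH2; rewrite !map_cat; exact: tens_cat.
- by move=> s t; rewrite !map_cat; exact: tens_catC.
- by move=> m; rewrite mulr0; exact: tens_0l.
- by move=> b' b'' m; rewrite mulrDr; exact: tens_Dl.
- by move=> b' m m'; exact: tens_Dr.
- by move=> b' a m; rewrite mulrA; exact: tens_Z.
Qed.

Lemma pi_tscale b s :
  tscale b (\pi_tensor s) = \pi_tensor [seq (b * p.1, p.2) | p <- s].
Proof. by apply/tens_pi; apply: tens_rel_scale; exact: repK. Qed.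

Fact taddA : associative tadd.
Proof.
elim/tens_ind=> s; elim/tens_ind=> t; elim/tens_ind=> u.
by rewrite !pi_tadd catA.
Qed.
Fact taddC : commutative tadd.
Proof.
elim/tens_ind=> s; elim/tens_ind=> t; rewrite !pi_tadd.
by apply/tens_pi; exact: tens_catC.
Qed.
Fact tadd0 : left_id tzero tadd.
Proof. by elim/tens_ind=> s; rewrite pi_tadd. Qed.
Fact taddN : left_inverse tzero topp tadd.
Proof.
elim/tens_ind=> s; rewrite /topp pi_tscale pi_tadd; apply/tens_pi.
elim: s => [|[b m] s IH] /=; first exact: tens_refl.
rewrite mulN1r.
apply: (tens_trans (t := ([:: (- b, m)] ++ [:: (b, m)]) ++
   ([seq (-1 * p.1, p.2) | p <- s] ++ s))).
  exact: (tens_ACA [:: _] _ [:: _]).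
rewrite -[X in tens_rel _ X]cat0s; apply: tens_cat => //=.
apply: tens_trans (tens_sym (tens_Dl _ _ _)) _.
by rewrite addNr; exact: tens_0l.
Qed.
HB.instance Definition _ := GRing.isZmodule.Build tensor taddA taddC tadd0 taddN.

Fact tscaleA a b x : tscale a (tscale b x) = tscale (a * b) x.
Proof.
elim/tens_ind: x => s; rewrite !pi_tscale -map_comp; congr (\pi_tensor _).
by apply: eq_map => p /=; rewrite mulrA.
Qed.
Fact tscale1 : left_id 1 tscale.
Proof.
elim/tens_ind=> s; rewrite pi_tscale -[in RHS](map_id s).
by congr (\pi_tensor _); apply: eq_map => -[b m] /=; rewrite mul1r.
Qed.
Fact tscaleDr : right_distributive tscale +%R.
Proof.
move=> b; elim/tens_ind=> s; elim/tens_ind=> t.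
by rewrite [X in tscale b X]pi_tadd !pi_tscale [RHS]pi_tadd map_cat.
Qed.
Fact tscaleDl x : {morph tscale^~ x : a b / a + b}.
Proof.
move=> a b; elim/tens_ind: x => s; rewrite !pi_tscale [RHS]pi_tadd; apply/tens_pi.
elim: s => [|[c m] s IH] /=; first exact: tens_refl.
apply: (tens_trans (t := ([:: (a * c, m)] ++ [:: (b * c, m)]) ++
   ([seq (a * p.1, p.2) | p <- s] ++ [seq (b * p.1, p.2) | p <- s]))).
  rewrite -cat1s; apply: tens_cat => //=.
  by rewrite mulrDl; exact: tens_Dl.
exact: (tens_ACA [:: _] [:: _]).
Qed.
HB.instance Definition _ := GRing.Zmodule_isLmodule.Build B tensor
  tscaleA tscale1 tscaleDr tscaleDl.

Definition tens_mk (b : B) (m : M) : tensor := \pi_tensor [:: (b, m)].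

Section Lift.
Variables (W : lmodType B) (f : {linear M -> W | i \; *:%R}).

(* The B-linear map B (x)_A M -> W, b (x) m |-> b f(m); this is 1 (x) f.      *)
Definition tens_lift (x : tensor) : W := \sum_(p <- repr x) p.1 *: f p.2.

Lemma tens_rel_sum s t : tens_rel s t ->
  \sum_(p <- s) p.1 *: f p.2 = \sum_(p <- t) p.1 *: f p.2.
Proof.
elim=> {s t}.
- by [].
- by move=> s t _ ->.
- by move=> s t u _ -> _ ->.
- by move=> s s' t t' _ IH1 _ IH2; rewrite !big_cat /= IH1 IH2.
- by move=> s t; rewrite !big_cat /= addrC.
- by move=> m; rewrite big_seq1 big_nil scale0r.
- by move=> b b' m; rewrite big_seq1 big_cons big_seq1 scalerDl.
- by move=> b m m'; rewrite big_seq1 big_cons big_seq1 linearD scalerDr.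
- by move=> b a m; rewrite !big_seq1 /= linearZ_LR /= scalerA.
Qed.

Lemma tens_lift_pi s :
  tens_lift (\pi_tensor s) = \sum_(p <- s) p.1 *: f p.2.
Proof. by apply: tens_rel_sum; exact: repK. Qed.

Lemma tens_liftE b m : tens_lift (tens_mk b m) = b *: f m.
Proof. by rewrite tens_lift_pi big_seq1. Qed.

Fact tens_lift_linear : linear tens_lift.
Proof.
move=> b; elim/tens_ind=> s; elim/tens_ind=> t.
rewrite [b *: _]pi_tscale [_ + _]pi_tadd !tens_lift_pi big_cat /= big_map.
by congr (_ + _); rewrite scaler_sumr; apply: eq_bigr => p _; rewrite scalerA.
Qed.
HB.instance Definition _ := GRing.isLinear.Build B tensor W _ tens_lift
  tens_lift_linear.
End Lift.
End Tensor.

(* Hom_B(V, B), made into an A-module through s by (a f)(v) = s(a) f(v).      *)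
Record twisted_dual (A B : comNzRingType) (s : {rmorphism A -> B})
  (V : lmodType B) := Tdual { tdual_map :> {linear V -> B^o} }.
Arguments Tdual {A B s V}.

Section TwistedDual.
Variables (A B : comNzRingType) (s : {rmorphism A -> B}) (V : lmodType B).
Notation tdual := (twisted_dual s V).

HB.instance Definition _ := gen_eqMixin tdual.
HB.instance Definition _ := gen_choiceMixin tdual.

Lemma tdualP (f g : tdual) : (forall v, f v = g v) -> f = g.
Proof.
case: f g => [[f fP]] [[g gP]] /= /funext fg; subst g.
congr (Tdual (GRing.Linear.Pack _)).
case: fP gP => [[a] [b]] [[c] [d]].
by rewrite (Prop_irrelevance a c) (Prop_irrelevance b d).
Qed.

Implicit Types f g : tdual.

Definition dzero : tdual := Tdual \0.
Definition dadd f g : tdual := Tdual (f \+ g).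

Definition opp_map f (v : V) : B^o := - f v.
Fact opp_linear f : linear (opp_map f).
Proof. by move=> b v w; rewrite /opp_map linearP opprD scalerN. Qed.
HB.instance Definition _ f := GRing.isLinear.Build B V B^o _ (opp_map f)
  (opp_linear f).
Definition dopp f : tdual := Tdual (opp_map f).

Definition scale_map a f (v : V) : B^o := s a * f v.
Fact scale_linear a f : linear (scale_map a f).
Proof.
by move=> b v w; rewrite /scale_map linearP mulrDr; congr (_ + _); exact: mulrCA.
Qed.
HB.instance Definition _ a f := GRing.isLinear.Build B V B^o _ (scale_map a f)
  (scale_linear a f).
Definition dscale a f : tdual := Tdual (scale_map a f).

Fact daddA : associative dadd.
Proof. by move=> f g h; apply: tdualP => v /=; rewrite addrA. Qed.
Fact daddC : commutative dadd.
Proof. by move=> f g; apply: tdualP => v /=; rewrite addrC. Qed.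
Fact dadd0 : left_id dzero dadd.
Proof. by move=> f; apply: tdualP => v /=; rewrite add0r. Qed.
Fact daddN : left_inverse dzero dopp dadd.
Proof. by move=> f; apply: tdualP => v; rewrite /= /opp_map addNr. Qed.
HB.instance Definition _ := GRing.isZmodule.Build tdual daddA daddC dadd0 daddN.

Fact dscaleA a b f : dscale a (dscale b f) = dscale (a * b) f.
Proof. by apply: tdualP => v; rewrite /= /scale_map /= rmorphM -mulrA. Qed.
Fact dscale1 : left_id 1 dscale.
Proof. by move=> f; apply: tdualP => v; rewrite /= /scale_map rmorph1 mul1r. Qed.
Fact dscaleDr : right_distributive dscale +%R.
Proof. by move=> a f g; apply: tdualP => v; exact: mulrDr. Qed.
Fact dscaleDl f : {morph dscale^~ f : a b / a + b}.
Proof. by move=> a b; apply: tdualP => v; rewrite /= /scale_map rmorphD mulrDl. Qed.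
HB.instance Definition _ := GRing.Zmodule_isLmodule.Build A tdual
  dscaleA dscale1 dscaleDr dscaleDl.

End TwistedDual.

Section TorsionQuotient.
Variables (F : fieldType) (R : realType) (Gam : zmodClosed R).
Variable H : lmodType (Lam F Gam).

Definition torsion : {pred H} :=
  fun x => `[< exists2 a : Lam F Gam, a != 0 & a *: x = 0 >].

Fact torsion_closed : zmod_closed torsion.
Proof.
split; first by apply/asboolP; exists 1; [exact: oner_neq0|rewrite scaler0].
move=> x y /asboolP[a a0 ax] /asboolP[b b0 by0]; apply/asboolP.
exists (a * b); first by rewrite Lam_mulf_eq0 negb_or a0.
by rewrite scalerBr {1}mulrC -!scalerA ax by0 !scaler0 subr0.
Qed.
HB.instance Definition _ := GRing.isZmodClosed.Build H torsion torsion_closed.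

Definition mod_torsion := Quotient.quot torsion.
HB.instance Definition _ := GRing.Zmodule.on mod_torsion.
HB.instance Definition _ := EqQuotient.on mod_torsion.

Lemma mod_torsionE x y :
  \pi_mod_torsion x = \pi_mod_torsion y <-> x - y \in torsion.
Proof.
by rewrite (rwP eqP) -[_ == _](Quotient.idealrBE torsion).
Qed.

Definition qscale (a : Lam F Gam) (x : mod_torsion) : mod_torsion :=
  \pi_mod_torsion (a *: repr x).

Lemma pi_qscale a x : qscale a (\pi_mod_torsion x) = \pi_mod_torsion (a *: x).
Proof.
apply/mod_torsionE; rewrite -scalerBr.
have /mod_torsionE/asboolP[b b0 bx] :
  \pi_mod_torsion (repr (\pi_mod_torsion x)) = \pi_mod_torsion x by exact: reprK.
by apply/asboolP; exists b => //; rewrite scalerA mulrC -scalerA bx scaler0.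
Qed.

Let qind (P : mod_torsion -> Prop) :
  (forall x, P (\pi_mod_torsion x)) -> forall x, P x.
Proof. by move=> PP x; rewrite -[x]reprK. Qed.

Let piD x y : \pi_mod_torsion x + \pi_mod_torsion y = \pi_mod_torsion (x + y).
Proof. exact: (esym (Quotient.pi_add torsion x y)). Qed.

Fact qscaleA a b x : qscale a (qscale b x) = qscale (a * b) x.
Proof. by elim/qind: x => x; rewrite !pi_qscale scalerA. Qed.
Fact qscale1 : left_id 1 qscale.
Proof. by elim/qind=> x; rewrite pi_qscale scale1r. Qed.
Fact qscaleDr : right_distributive qscale +%R.
Proof.
by move=> a; elim/qind=> x; elim/qind=> y; rewrite piD !pi_qscale piD scalerDr.
Qed.
Fact qscaleDl x : {morph qscale^~ x : a b / a + b}.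
Proof. by move=> a b; elim/qind: x => x; rewrite !pi_qscale piD scalerDl. Qed.
HB.instance Definition _ := GRing.Zmodule_isLmodule.Build (Lam F Gam) mod_torsion
  qscaleA qscale1 qscaleDr qscaleDl.
End TorsionQuotient.

Section Norms.
Variables (F : fieldType) (R : realType) (Gam : zmodClosed R).
Notation L := (Lam F Gam).
Notation Lup := (Lam_up F Gam).
Notation Ldown := (Lam_down F Gam).
Local Open Scope ereal_scope.

(* These are a minimum and a maximum when a != 0: see nu_upP and nu_downP.    *)
Definition nu_up (a : Lup) : \bar R :=
  ereal_inf [set g%:E | g in [set g : R | a g != 0%R]].
Definition nu_down (a : Ldown) : \bar R :=
  ereal_sup [set g%:E | g in [set g : R | a g != 0%R]].

Lemma nu_upP (a : Lup) : a != 0%R -> exists2 g : R, a g != 0%R & nu_up a = g%:E.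
Proof.
move=> /series_neq0[x ax]; have [m am mP] := up_min (coef_supp a) ax.
exists m => //; apply/eqP; rewrite eq_le; apply/andP; split.
  by apply: ereal_inf_lbound; exists m.
by apply: le_ereal_inf_tmp => _ [g ag <-]; rewrite lee_fin mP.
Qed.

Lemma nu_downP (a : Ldown) :
  a != 0%R -> exists2 g : R, a g != 0%R & nu_down a = g%:E.
Proof.
move=> /series_neq0[x ax].
have [|m am mP] := @up_min R Gam _ (- x)%R (N_down (coef_supp a)).
  by rewrite /= opprK.
exists (- m)%R => //; apply/eqP; rewrite eq_le; apply/andP; split; last first.
  by apply: ereal_sup_ubound; exists (- m)%R.
apply: ge_ereal_sup => _ [g ag <-]; rewrite lee_fin lerNr.
by apply: mP; rewrite /= opprK.
Qed.

Definition is_normed_up (V : lmodType Lup) (rho : V -> \bar R) : Prop :=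
  [/\ fin_gen V,
      forall x, rho x != +oo,
      forall x, rho x = -oo <-> x = 0%R,
      forall (a : Lup) x, rho (a *: x)%R = rho x - nu_up a &
      forall x y, rho (x + y)%R <= maxe (rho x) (rho y)].

Definition is_normed_down (V : lmodType Ldown) (rho : V -> \bar R) : Prop :=
  [/\ fin_gen V,
      forall x, rho x != -oo,
      forall x, rho x = +oo <-> x = 0%R,
      forall (a : Ldown) x, rho (a *: x)%R = rho x - nu_down a &
      forall x y, rho (x + y)%R >= mine (rho x) (rho y)].

Definition orthogonal_up (V : lmodType Lup) (rho : V -> \bar R)
    (s : seq V) : Prop :=
  forall c : 'I_(size s) -> Lup,
    rho (lincomb c) = \big[maxe/-oo]_(i < size s) (rho s`_i%R - nu_up (c i)).

Definition orthogonal_down (V : lmodType Ldown) (rho : V -> \bar R)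
    (s : seq V) : Prop :=
  forall c : 'I_(size s) -> Ldown,
    rho (lincomb c) = \big[mine/+oo]_(i < size s) (rho s`_i%R - nu_down (c i)).

Definition dualL (H : lmodType L) := twisted_dual (@conjL F R Gam) H.
Definition dual_up (V : lmodType Lup) := twisted_dual (@conj_down F R Gam) V.

Definition dual_norm (V : lmodType Lup) (rho : V -> \bar R)
    (z : dual_up V) : \bar R :=
  ereal_inf [set nu_up (z x) + rho x | x in [set x : V | x != 0%R]].

End Norms.
HB.instance Definition _ F R Gam H := GRing.Lmodule.on (@dualL F R Gam H).
HB.instance Definition _ F R Gam V := GRing.Lmodule.on (@dual_up F R Gam V).

Section MatchedPairs.
Variables (F : fieldType) (R : realType) (Gam : zmodClosed R).
Notation L := (Lam F Gam).
Notation Lup := (Lam_up F Gam).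
Notation Ldown := (Lam_down F Gam).

(* The data of a filtered matched pair; the axioms are stated separately in   *)
(* is_filtered_matched_pair. Doubly-orthogonal bases and the basis spectrum   *)
(* only involve the data. The pairs PN_pair N k below satisfy the axioms as a *)
(* consequence of those of N, so these are not assumed anywhere.              *)
Record pair_data := PairData {
  mpH : lmodType L;
  mpUp : lmodType Lup;
  rho_up : mpUp -> \bar R;
  mpDown : lmodType Ldown;
  rho_down : mpDown -> \bar R;
  phi_up : {linear mpH -> mpUp | @to_up F R Gam \; *:%R};
  phi_down : {linear mpH -> mpDown | @to_down F R Gam \; *:%R} }.

Definition is_filtered_matched_pair (P : pair_data) : Prop :=
  [/\ fin_gen (mpH P), is_normed_up (@rho_up P), is_normed_down (@rho_down P),
      bijective (tens_lift (phi_up P)) & bijective (tens_lift (phi_down P))].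

Definition doubly_orthogonal_basis (P : pair_data) (e : seq (mpH P)) : Prop :=
  [/\ is_basis [seq (\pi_(mod_torsion (mpH P)) x : mod_torsion (mpH P)) | x <- e],
      is_basis [seq phi_up P x | x <- e],
      orthogonal_up (@rho_up P) [seq phi_up P x | x <- e],
      is_basis [seq phi_down P x | x <- e] &
      orthogonal_down (@rho_down P) [seq phi_down P x | x <- e]].

Definition RmodG := Quotient.quot Gam.

Definition spectrum_of (P : pair_data) (e : seq (mpH P)) : seq (RmodG * R) :=
  [seq (\pi_RmodG (fine (rho_up (phi_up P x))),
        fine (rho_down (phi_down P x)) - fine (rho_up (phi_up P x))) | x <- e].

(* The multiset of pairs, listed for an arbitrarily chosen doubly-orthogonal  *)
(* basis; up to permutation it does not depend on the choice.                 *)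
Definition basis_spectrum (P : pair_data) : seq (RmodG * R) :=
  spectrum_of (xget [::] [set e : seq (mpH P) | doubly_orthogonal_basis e]).

End MatchedPairs.

(* D_k : H_k -> vH_{n-k} is indexed by pairs (k, l) with k + l = n, so that   *)
(* the symmetry of D_k and D_{n-k} needs no cast between H_{n-(n-k)} and H_k; *)
(* equality proofs in int being unique, D depends on k only.                  *)
Record strong_PN_structure (F : fieldType) (R : realType) (Gam : zmodClosed R)
    (n : int) := StrongPN {
  PN_H : int -> lmodType (Lam F Gam);
  PN_D : forall k l : int, k + l = n -> {linear PN_H k -> dualL (PN_H l)};
  PN_V : int -> lmodType (Lam_up F Gam);
  PN_rho : forall k, PN_V k -> \bar R;
  PN_S : forall k, {linear PN_H k -> PN_V k | @to_up F R Gam \; *:%R};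
  PN_H_fg : forall k, fin_gen (PN_H k);
  PN_D_sym : forall (k l : int) (kl : k + l = n) (lk : l + k = n),
    exists b : bool, forall (x : PN_H k) (y : PN_H l),
      PN_D kl x y = (-1) ^+ b * conjL (PN_D lk y x);
  PN_D_surj : forall (k l : int) (kl : k + l = n) (z : dualL (PN_H l)),
    exists x, PN_D kl x = z;
  PN_D_ker : forall (k l : int) (kl : k + l = n) (x : PN_H k),
    PN_D kl x = 0 <-> torsion x;
  PN_normed : forall k, is_normed_up (@PN_rho k);
  PN_S_iso : forall k, bijective (tens_lift (PN_S k)) }.

Section PoincareNovikov.
Variables (F : fieldType) (R : realType) (Gam : zmodClosed R) (n : int).
Variable N : strong_PN_structure F Gam n.
Notation L := (Lam F Gam).
Notation Lup := (Lam_up F Gam).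

Section STilde.
Variables (k l : int) (kl : k + l = n).

(* The inverse of 1 (x) S_l.                                                  *)
Definition S_inv (v : PN_V N l) : tensor (@to_up F R Gam) (PN_H N l) :=
  xget 0 [set t | tens_lift (PN_S N l) t = v].

Lemma S_invK v : tens_lift (PN_S N l) (S_inv v) = v.
Proof.
have [g _ gK] := PN_S_iso N l.
by apply: (xgetPex 0 (P := [set t | tens_lift (PN_S N l) t = v])); exists (g v); exact: gK.
Qed.

Lemma S_invE t : S_inv (tens_lift (PN_S N l) t) = t.
Proof. by apply: (bij_inj (PN_S_iso N l)); exact: S_invK. Qed.

Definition D_up (x : PN_H N k) (y : PN_H N l) : Lup^o := to_up (PN_D N kl x y).

Fact D_up_zmod x : zmod_morphism (D_up x).
Proof. by move=> y z; rewrite /D_up linearB; exact: (rmorphB (@to_up F R Gam)). Qed.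
HB.instance Definition _ x := GRing.isZmodMorphism.Build _ _ (D_up x)
  (D_up_zmod x).
Fact D_up_scalable x : scalable_for (@to_up F R Gam \; *:%R) (D_up x).
Proof. by move=> a y; rewrite /D_up linearZ; exact: (rmorphM (@to_up F R Gam)). Qed.
HB.instance Definition _ x := GRing.isScalable.Build _ _ _ _ (D_up x)
  (D_up_scalable x).

Definition Stilde_map (x : PN_H N k) (v : PN_V N l) : Lup^o :=
  tens_lift (D_up x) (S_inv v).

Fact Stilde_map_linear x : linear (Stilde_map x).
Proof.
move=> a v w; rewrite /Stilde_map -linearP; congr (tens_lift _ _).
by apply: (bij_inj (PN_S_iso N l)); rewrite linearP /= !S_invK.
Qed.
HB.instance Definition _ x := GRing.isLinear.Build Lup (PN_V N l) Lup^o _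
  (Stilde_map x) (Stilde_map_linear x).

(* The unique functional with Stilde x (S_l y) = D_k x y, namely              *)
(* (1 (x) D_k x) \o (1 (x) S_l)^-1: see Stilde_S and Stilde_unique.           *)
Definition Stilde (x : PN_H N k) : dual_up (PN_V N l) := Tdual (Stilde_map x).

Lemma Stilde_S x y : Stilde x (PN_S N l y) = to_up (PN_D N kl x y).
Proof.
rewrite /= /Stilde_map.
have -> : PN_S N l y = tens_lift (PN_S N l) (tens_mk _ 1 y).
  by rewrite tens_liftE scale1r.
by rewrite S_invE tens_liftE scale1r.
Qed.

Lemma Stilde_unique (x : PN_H N k) (z : dual_up (PN_V N l)) :
  (forall y, z (PN_S N l y) = to_up (PN_D N kl x y)) -> z = Stilde x.
Proof.
move=> zP; apply: tdualP => v; rewrite -(S_invK v).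
rewrite /= /tens_lift !linear_sum; apply: eq_bigr => p _.
by rewrite !linearZ zP -Stilde_S.
Qed.

Fact Stilde_zmod : zmod_morphism Stilde.
Proof.
move=> x x'; apply/esym/Stilde_unique => y.
transitivity (Stilde x (PN_S N l y) - Stilde x' (PN_S N l y)); first by [].
by rewrite !Stilde_S linearB; exact/esym/(rmorphB (@to_up F R Gam)).
Qed.
HB.instance Definition _ := GRing.isZmodMorphism.Build _ _ Stilde Stilde_zmod.
Fact Stilde_scalable : scalable_for (@to_down F R Gam \; *:%R) Stilde.
Proof.
move=> a x; apply/esym/Stilde_unique => y.
transitivity (conj_down (to_down a) * Stilde x (PN_S N l y)); first by [].
rewrite Stilde_S conj_to_down linearZ.
exact/esym/(rmorphM (@to_up F R Gam)).
Qed.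
HB.instance Definition _ := GRing.isScalable.Build _ _ _ _ Stilde
  Stilde_scalable.

End STilde.

Lemma subrK_deg (k : int) : k + (n - k) = n.
Proof. by rewrite addrC subrK. Qed.

Definition PN_pair (k : int) : pair_data F Gam :=
  PairData (@PN_rho _ _ _ _ N k) (@dual_norm F R Gam _ (@PN_rho _ _ _ _ N (n - k)))
    (PN_S N k) (Stilde (subrK_deg k)).

(* The class I^Gam of the translates of I by elements of Gam.                 *)
Definition itv_class (I : set R) : set (set R) :=
  [set [set x + g | x in I] | g in [set` Gam]].

Definition barcode (k : int) : seq (set (set R)) :=
  [seq itv_class `[repr p.1, repr p.1 + p.2]
     | p <- basis_spectrum (PN_pair k) & 0 <= p.2] ++
  [seq itv_class `]repr p.1 + p.2, repr p.1[
     | p <- basis_spectrum (PN_pair (k + 1)) & p.2 < 0].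

(* The disjoint union over k of the multisets B_k: an element is a degree     *)
(* together with a position in the list B_k.                                  *)
Definition bars : Type := {k : int & 'I_(size (barcode k))}.
Definition bar_deg (x : bars) : int := tag x.
Definition bar_itv (x : bars) : set (set R) :=
  tnth (in_tuple (barcode (tag x))) (tagged x).

End PoincareNovikov.

Definition fg_subgroup (R : realType) (Gam : zmodClosed R) : Prop :=
  exists s : seq R, forall x : R,
    x \in Gam <-> exists c : 'I_(size s) -> int, x = \sum_(i < size s) s`_i *~ c i.

(* Main.v *)
Require Import Defs.
From HB Require Import structures.
From mathcomp Require Import all_boot all_order all_algebra.
From mathcomp Require Import perm.
From mathcomp Require Import all_classical all_reals ereal lra.

Set Implicit Arguments.
Unset Strict Implicit.
Unset Printing Implicit Defensive.

Import Order.TTheory GRing.Theory Num.Theory.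

Local Open Scope classical_set_scope.
Local Open Scope ring_scope.
Local Open Scope quotient_scope.

(** Let e and f be doubly-orthogonal bases in complementary degrees k and
l = n - k, with norms a_i = rho (S e_i), b_i = dual norm of S~ e_i, and
likewise a'_j, b'_j for f. The matrix G_ij = D e_i f_j of the Poincare pairing
is a matrix over Lambda whose entries are confined by the four norms: the
definition of the dual norm as an infimum, together with the symmetry of D,
puts all exponents of G_ij in [b_i - a'_j, a_i - b'_j] ([dualS_le]).

G is invertible over Lambda, and its inverse is confined by the opposite
bounds. Indeed D is onto, so some x_j in H_k pairs with the f_m as the dual
basis of f; the coordinates of x_j on e, conjugated, form row j of the inverse.
Orthogonality of S f makes the dual norm of S~ x_j at least a'_j, and
orthogonality of the S~ e_i then bounds the exponents of those coordinates
([pairing_left_inverse]). Exchanging the roles of e and f gives the other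
bound.

A matrix with a nonzero determinant has a permutation along which no entry
vanishes. Applied to G this gives s with b_i - a'_(s i) <= a_i - b'_(s i) for
all i, and applied to the inverse it gives the reverse inequality between the
sums over i. So all these inequalities are equalities, and G_(i, s i) is
a monomial with exponent b_i - a'_(s i), which therefore lies in Gamma
([support_matching], [norm_duality]). Hence s carries each element ([a], ell)
of the spectrum in degree k to ([a + ell], - ell) in degree l. This holds for
any two doubly-orthogonal bases, so it needs neither the independence of the
spectrum from the basis nor the existence of a dual doubly-orthogonal basis.

Finally the bars of all degrees are in bijection with the positions in all the
spectra, a position with ell >= 0 of degree m giving a closed bar of degree m
and one with ell < 0 an open bar of degree m - 1 ([bars_positions]). The
matching of the spectra becomes the required bijection of bars; the endpoints
of an interval are recovered from its class up to a common translation. *)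

(** * Bases and orthogonality for indexed families *)

Section Families.
Variables (A : nzRingType) (M : lmodType A).

(** [v] is a basis, for a family indexed by ordinals instead of a list: this
avoids the index types ['I_(size [seq h x | x <- e])]. *)
Definition family_basis (d : nat) (v : 'I_d -> M) : Prop :=
  (forall x, exists c : 'I_d -> A, x = \sum_i c i *: v i) /\
  (forall c c' : 'I_d -> A,
     \sum_i c i *: v i = \sum_i c' i *: v i -> c =1 c').

Lemma is_basis_family (s : seq M) d (v : 'I_d -> M) : size s = d ->
  (forall i : 'I_d, s`_i = v i) -> is_basis s -> family_basis v.
Proof.
move=> sd; case: _ / sd v => v sv bs.
have lcE (c : 'I_(size s) -> A) : \sum_i c i *: v i = lincomb c.
  by apply: eq_bigr => i _; rewrite sv.
split=> [x|c c'].
  by have [c [-> _]] := bs x; exists c; rewrite lcE.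
rewrite !lcE => cc' i; have [c0 [_ c0P]] := bs (lincomb c).
have lf (c1 : 'I_(size s) -> A) : lincomb (finfun c1) = lincomb c1.
  by apply: eq_bigr => j _; rewrite ffunE.
have e1 := c0P (finfun c) (esym (lf c)).
have e2 := c0P (finfun c') (etrans cc' (esym (lf c'))).
have := congr1 (fun h : {ffun _ -> A} => h i) (etrans (esym e1) e2).
by rewrite !ffunE.
Qed.

Lemma is_basis_map (M' : zmodType) (h : M' -> M) (e : seq M') :
  is_basis [seq h x | x <- e] -> family_basis (fun i : 'I_(size e) => h e`_i).
Proof.
apply: is_basis_family; first by rewrite size_map.
by move=> i; rewrite (nth_map 0).
Qed.

End Families.

Section Orthogonality.
Variables (F : fieldType) (R : realType) (Gam : zmodClosed R).
Notation L := (Lam F Gam).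
Notation Lup := (Lam_up F Gam).
Notation Ldown := (Lam_down F Gam).
Local Open Scope ereal_scope.

Lemma nu_up_le (u : Lup) (g : R) : u g != 0%R -> nu_up u <= g%:E.
Proof. by move=> ug; apply: ereal_inf_lbound; exists g. Qed.

Lemma nu_down_ge (u : Ldown) (g : R) : u g != 0%R -> g%:E <= nu_down u.
Proof. by move=> ug; apply: ereal_sup_ubound; exists g. Qed.

Lemma nu_up0 : nu_up (0%R : Lup) = +oo.
Proof.
rewrite /nu_up (_ : [set _ | _ in _] = set0) ?ereal_inf0 //.
by apply/seteqP; split => // x [g /=]; rewrite eqxx.
Qed.

Lemma orthogonal_up_ge (V : lmodType Lup) (rho : V -> \bar R) (M' : zmodType)
    (h : M' -> V) (e : seq M') (c : 'I_(size e) -> Lup) (j : 'I_(size e)) :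
  orthogonal_up rho [seq h x | x <- e] ->
  rho (h e`_j)%R - nu_up (c j) <= rho (\sum_i c i *: h e`_i)%R.
Proof.
suff gen (s : seq V) d (v : 'I_d -> V) (c' : 'I_d -> Lup) (j' : 'I_d) :
    size s = d -> (forall i : 'I_d, s`_i%R = v i) -> orthogonal_up rho s ->
    rho (v j') - nu_up (c' j') <= rho (\sum_i c' i *: v i)%R.
  apply: (gen _ _ (fun i => h e`_i)%R c); first by rewrite size_map.
  by move=> i; rewrite (nth_map 0%R).
move=> sd; case: _ / sd v c' j' => v c' j' sv os.
have -> : (\sum_i c' i *: v i)%R = lincomb c'.
  by apply: eq_bigr => i _; rewrite sv.
by rewrite os -sv; exact: (le_bigmax _ _ j').
Qed.

Lemma orthogonal_down_le (V : lmodType Ldown) (rho : V -> \bar R)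
    (M' : zmodType) (h : M' -> V) (e : seq M') (c : 'I_(size e) -> Ldown)
    (j : 'I_(size e)) :
  orthogonal_down rho [seq h x | x <- e] ->
  rho (\sum_i c i *: h e`_i)%R <= rho (h e`_j)%R - nu_down (c j).
Proof.
suff gen (s : seq V) d (v : 'I_d -> V) (c' : 'I_d -> Ldown) (j' : 'I_d) :
    size s = d -> (forall i : 'I_d, s`_i%R = v i) -> orthogonal_down rho s ->
    rho (\sum_i c' i *: v i)%R <= rho (v j') - nu_down (c' j').
  apply: (gen _ _ (fun i => h e`_i)%R c); first by rewrite size_map.
  by move=> i; rewrite (nth_map 0%R).
move=> sd; case: _ / sd v c' j' => v c' j' sv os.
have -> : (\sum_i c' i *: v i)%R = lincomb c'.
  by apply: eq_bigr => i _; rewrite sv.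
by rewrite os -sv; exact: (bigmin_le _ j').
Qed.

Lemma dual_norm_le (V : lmodType Lup) (rho : V -> \bar R) (z : dual_up V)
    (x : V) (g : R) : (z x : Lup) g != 0%R -> dual_norm rho z <= g%:E + rho x.
Proof.
move=> zx; have x0 : x != 0%R.
  by apply: contra_neq zx => ->; rewrite linear0.
apply: le_trans (leeD2r (rho x) (nu_up_le zx)).
by apply: ereal_inf_lbound; exists x.
Qed.

(** If [z] is the [j]-th element of the basis dual to an orthogonal basis
[h e], then its dual norm is at least the norm of [h e_j]. *)
Lemma dual_norm_ge (V : lmodType Lup) (rho : V -> \bar R) (M' : zmodType)
    (h : M' -> V) (e : seq M') (j : 'I_(size e)) (z : dual_up V) :
  is_normed_up rho -> is_basis [seq h x | x <- e] ->
  orthogonal_up rho [seq h x | x <- e] ->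
  (forall i : 'I_(size e), z (h e`_i)%R = (j == i)%:R%R) ->
  rho (h e`_j)%R <= dual_norm rho z.
Proof.
move=> [_ rhoN rho0 _ _] /is_basis_map[span _] orth zh.
apply: le_ereal_inf_tmp => _ [v v0 <-].
(* On v = \sum_i c_i (h e_i) the functional z takes the value c_j, while
   orthogonality gives rho v >= rho (h e_j) - nu_up c_j. *)
have [c vc] := span v.
have zv : z v = c j.
  rewrite vc linear_sum /= (bigD1 j) //= linearZ /= zh eqxx.
  rewrite big1 ?addr0 => [|i /negbTE ij]; first exact: mulr1.
  by rewrite linearZ /= zh eq_sym ij; exact: mulr0.
have := orthogonal_up_ge c j orth; rewrite -vc zv.
have [->|cj0] := eqVneq (c j) 0%R.
  move=> _; rewrite nu_up0 addye ?leey //.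
  by apply/eqP => /rho0 v_eq0; move: v0; rewrite /= v_eq0 eqxx.
by have [g _ ->] := nu_upP cj0; rewrite leeBlDl // addeC.
Qed.

End Orthogonality.

(** * The pairing matrix and its inverse *)

Section Pairing.
Variables (F : fieldType) (R : realType) (Gam : zmodClosed R).
Notation L := (Lam F Gam).

Lemma twisted_dual_sum (A B : comNzRingType) (s : {rmorphism A -> B})
    (V : lmodType B) d (z : 'I_d -> twisted_dual s V) (v : V) :
  (\sum_i z i) v = \sum_i z i v.
Proof.
apply: (big_ind2 (fun (g : twisted_dual s V) a => g v = a)) => //=.
by move=> g a h b <- <-.
Qed.

Lemma pi_torsionD (H : lmodType L) (x y : H) :
  \pi_(mod_torsion H) (x + y) =
  (\pi_(mod_torsion H) x : mod_torsion H) + \pi_(mod_torsion H) y.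
Proof. exact: (Quotient.pi_add (@torsion F R Gam H)). Qed.

Lemma pi_torsion_sum (H : lmodType L) d (c : 'I_d -> L) (x : 'I_d -> H) :
  \pi_(mod_torsion H) (\sum_i c i *: x i) =
  \sum_i c i *: (\pi_(mod_torsion H) (x i) : mod_torsion H).
Proof.
apply: (big_ind2 (fun a b => \pi_(mod_torsion H) a = b)).
- by apply: (addrI (\pi_(mod_torsion H) 0)); rewrite -pi_torsionD !addr0.
- by move=> a _ b _ <- <-; exact: pi_torsionD.
- by move=> i _; exact/esym/pi_qscale.
Qed.

(** The dual basis of a family of elements of [H] that is a basis modulo
torsion, as functionals on [H]. *)
Lemma dual_functional (H : lmodType L) d (f : 'I_d -> H) (j : 'I_d) :
  family_basis (fun i => \pi_(mod_torsion H) (f i) : mod_torsion H) ->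
  exists z : dualL H, forall i, z (f i) = (j == i)%:R.
Proof.
move=> [span free].
have /choice[c cP] : forall x : H, exists c : 'I_d -> L,
    \pi_(mod_torsion H) x =
    \sum_i c i *: (\pi_(mod_torsion H) (f i) : mod_torsion H).
  by move=> x; have [c cx] := span (\pi_(mod_torsion H) x); exists c.
have cE x c' : \pi_(mod_torsion H) x =
    \pi_(mod_torsion H) (\sum_i c' i *: f i) -> c x =1 c'.
  by rewrite cP pi_torsion_sum; exact: free.
pose z0 x : L^o := c x j.
have z0l : linear z0.
  move=> a x y; rewrite /z0.
  rewrite (cE (a *: x + y) (fun i => a * c x i + c y i)) //.
  transitivity (a *: (\pi_(mod_torsion H) x : mod_torsion H) +
                \pi_(mod_torsion H) y).
    by rewrite pi_torsionD; congr (_ + _); exact/esym/pi_qscale.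
  rewrite pi_torsion_sum [in LHS](cP x) [in LHS](cP y) scaler_sumr -big_split.
  by apply: eq_bigr => i _; rewrite scalerDl scalerA.
pose z : {linear H -> L^o} := HB.pack z0 (GRing.isLinear.Build _ _ _ _ z0 z0l).
exists (Tdual z) => i; rewrite /= /z0.
rewrite (cE (f i) (fun m => (m == i)%:R)) //.
congr (\pi_(mod_torsion H) _).
rewrite (bigD1 i) //= eqxx scale1r big1 ?addr0 //.
by move=> m /negbTE ->; rewrite scale0r.
Qed.

Variables (n : int) (N : strong_PN_structure F Gam n).

Lemma Stilde_eqD k l (kl : k + l = n) (x x' : PN_H N k) :
  PN_D N kl x = PN_D N kl x' -> Stilde kl x = Stilde kl x'.
Proof. by move=> xx'; apply: Stilde_unique => y; rewrite Stilde_S xx'. Qed.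

Lemma PN_D_torsion k l (kl : k + l = n) (x x' : PN_H N k) :
  \pi_(mod_torsion (PN_H N k)) x = \pi_(mod_torsion (PN_H N k)) x' ->
  PN_D N kl x = PN_D N kl x'.
Proof.
by move=> /mod_torsionE /(PN_D_ker kl) /eqP; rewrite linearB subr_eq0 => /eqP.
Qed.

(** The filtered matched pair of degree [k], with the complementary degree
given as an arbitrary [l] such that [k + l = n]. This makes the degrees [k] and
[l] symmetric, with no cast along [n - (n - k) = k]. *)
Definition Stilde_pair k l (kl : k + l = n) : pair_data F Gam :=
  PairData (@PN_rho _ _ _ _ N k) (@dual_norm F R Gam _ (@PN_rho _ _ _ _ N l))
    (PN_S N k) (Stilde kl).

Lemma Stilde_pairE k l (kl : k + l = n) : Stilde_pair kl = PN_pair N k.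
Proof.
have ll : l = n - k by rewrite -kl [k + l]addrC addrK.
by subst l; rewrite /PN_pair (eq_irrelevance kl (subrK_deg n k)).
Qed.

Local Notation dob kl e := (@doubly_orthogonal_basis F R Gam (Stilde_pair kl) e).

(** The rows of a left inverse of the pairing matrix, conjugated: [K j] lists
the coordinates on [e], modulo torsion, of an element of [H_k] that [D] sends to
the [j]-th functional of the basis dual to [f]. *)
Lemma pairing_left_inverse k l (kl : k + l = n) (lk : l + k = n)
    (e : seq (PN_H N k)) (f : seq (PN_H N l)) : dob kl e -> dob lk f ->
  exists K : 'I_(size f) -> 'I_(size e) -> L,
    (forall j m : 'I_(size f),
      \sum_i conjL (K j i) * PN_D N kl e`_i f`_m = (j == m)%:R) /\
    forall j i (g : R), K j i g != 0 ->
      (PN_rho (PN_S N l f`_j) <=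
       dual_norm (@PN_rho _ _ _ _ N l) (Stilde kl e`_i) - g%:E)%E.
Proof.
move=> [eb _ _ _ eo] [fb fS fo _ _].
have {eb} [espan _] := is_basis_map eb.
have {}fb := is_basis_map fb.
have /choice[x xP] : forall j : 'I_(size f), exists x : PN_H N k,
    forall i : 'I_(size f), PN_D N kl x f`_i = (j == i)%:R.
  move=> j; have [z zP] := dual_functional j fb.
  by have [x xz] := PN_D_surj kl z; exists x => i; rewrite xz zP.
have /choice[K KP] : forall j : 'I_(size f), exists c : 'I_(size e) -> L,
    \pi_(mod_torsion (PN_H N k)) (x j) =
    \pi_(mod_torsion (PN_H N k)) (\sum_i c i *: e`_i).
  move=> j; have [c cx] := espan (\pi_(mod_torsion (PN_H N k)) (x j)).
  by exists c; rewrite pi_torsion_sum.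
have DK j : PN_D N kl (x j) = PN_D N kl (\sum_i K j i *: e`_i).
  exact: PN_D_torsion.
exists K; split=> [j m|j i g Kg].
  rewrite -xP DK linear_sum twisted_dual_sum; apply: eq_bigr => i _.
  by rewrite linearZ.
(* Both sides are compared with the dual norm of
   S~ x_j = \sum_i K_ji (S~ e_i). *)
have -> : Stilde kl e`_i = phi_down (Stilde_pair kl) e`_i by [].
apply: le_trans (leeB (lexx _) (nu_down_ge (u := to_down (K j i)) Kg)).
apply: le_trans (orthogonal_down_le (fun i => to_down (K j i)) i eo).
have -> : \sum_i to_down (K j i) *: phi_down (Stilde_pair kl) e`_i =
    Stilde kl (x j) :> dual_up _.
  rewrite (Stilde_eqD (DK j)) linear_sum; apply: eq_bigr => m _.
  by rewrite linearZ.
apply: (dual_norm_ge (PN_normed N l) fS fo) => m.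
by rewrite Stilde_S xP; case: (j == m); rewrite ?rmorph1 ?rmorph0.
Qed.

End Pairing.

(** * Matching the norms of two doubly-orthogonal bases *)

Section Matching.
Variables (F : fieldType) (R : realType) (Gam : zmodClosed R).
Notation L := (Lam F Gam).

Lemma nonzero_transversal (A : comNzRingType) d (G K : 'M[A]_d) :
  G *m K = 1%:M -> exists s : 'S_d, forall i, G i (s i) != 0.
Proof.
move=> GK; have dG : \det G != 0.
  apply/eqP => dG; have /eqP := congr1 (@determinant A d) GK.
  by rewrite det_mulmx dG mul0r det1 eq_sym oner_eq0.
apply: contrapT => no; move/eqP: dG; apply.
rewrite /determinant; apply: big1 => s _.
have [i /negPn/eqP Gi] : exists i, ~~ (G i (s i) != 0).
  apply: contrapT => noi; apply: no; exists s => i.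
  by case: (boolP (_ != 0)) => // Gi; case: noi; exists i.
by rewrite (bigD1 i) //= Gi mul0r mulr0.
Qed.

Lemma mulmx1_neq0 (A : comNzRingType) m p (G : 'M[A]_(m, p))
    (K : 'M[A]_(p, m)) i :
  G *m K = 1%:M -> exists2 j, G i j != 0 & K j i != 0.
Proof.
move=> GK; apply: contrapT => no.
have /eqP := congr1 (fun M : 'M[A]_m => M i i) GK.
rewrite !mxE eqxx big1 ?(eq_sym 0) ?oner_eq0 // => j _.
have [->|Gij] := eqVneq (G i j) 0; first by rewrite mul0r.
have [->|Kji] := eqVneq (K j i) 0; first by rewrite mulr0.
by case: no; exists j.
Qed.

Lemma fin_supp_Gam (u : L) g : u g != 0 -> g \in Gam.
Proof. by move=> ug; case: (coef_supp u) => + _; exact. Qed.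

Lemma eq_sum_ler (I : finType) (x y : I -> R) : (forall i, x i <= y i) ->
  \sum_i y i <= \sum_i x i -> x =1 y.
Proof.
move=> xy yx i; apply/esym/eqP; rewrite -subr_eq0.
have /psumr_eq0P H : forall i, true -> 0 <= y i - x i.
  by move=> j _; rewrite subr_ge0.
apply/eqP/H => //; apply/eqP; rewrite eq_le sumr_ge0 ?andbT; last first.
  by move=> j _; rewrite subr_ge0.
by rewrite sumrB subr_le0.
Qed.

(** If an invertible matrix over [Lambda] and its inverse have supports confined
to opposite families of intervals, then some transversal consists of monomials,
for which the interval is a single point of [Gamma]. *)
Lemma support_matching d d' (G : 'M[L]_(d, d')) (K : 'M[L]_(d', d))
    (a b : 'I_d -> R) (a' b' : 'I_d' -> R) :
  G *m K = 1%:M -> K *m G = 1%:M ->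
  (forall i j g, G i j g != 0 -> b i - a' j <= g <= a i - b' j) ->
  (forall j i g, K j i g != 0 -> a' j - b i <= g <= b' j - a i) ->
  exists2 s : 'I_d -> 'I_d', bijective s &
    forall i, b i - a' (s i) \in Gam /\ b i - a' (s i) = a i - b' (s i).
Proof.
move=> GK KG; have dd' : d = d'.
  by apply/eqP; rewrite eqn_leq (mulmx1_min GK) (mulmx1_min KG).
subst d' => suppG suppK.
have [s sP] := nonzero_transversal GK; have [t tP] := nonzero_transversal KG.
have sG i : exists2 g, G i (s i) g != 0 & b i - a' (s i) <= g <= a i - b' (s i).
  by have [g Gg] := series_neq0 (sP i); exists g => //; exact: suppG.
have tK j : a' j - b (t j) <= b' j - a (t j).
  have [g /suppK/andP[]] := series_neq0 (tP j); exact: le_trans.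
(* The transversal t of K bounds the sums over i in the direction opposite to
   that given termwise by the transversal s of G. *)
have eqs : (fun i => b i - a' (s i)) =1 (fun i => a i - b' (s i)).
  apply: eq_sum_ler => [i|]; first by have [g _ /andP[]] := sG i; exact: le_trans.
  have : \sum_j (a' j - b (t j)) <= \sum_j (b' j - a (t j)) by apply: ler_sum.
  rewrite !sumrB.
  rewrite -(reindex_inj (@perm_inj _ t) (P := xpredT) (F := b)).
  rewrite -(reindex_inj (@perm_inj _ t) (P := xpredT) (F := a)).
  rewrite -(reindex_inj (@perm_inj _ s) (P := xpredT) (F := a')).
  rewrite -(reindex_inj (@perm_inj _ s) (P := xpredT) (F := b')).
  lra.
exists s => [|i]; first exact: (injF_bij (@perm_inj _ s)).
split; last exact: eqs.
have [g Gg] := sG i; rewrite -(eqs i) -eq_le => /eqP ->.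
exact: fin_supp_Gam Gg.
Qed.

Lemma conjLK : involutive (@conjL F R Gam).
Proof. by move=> u; apply: seriesP => x /=; rewrite opprK. Qed.

Lemma coef_signM (s : bool) (u : L) g :
  (((-1) ^+ s * u) g != 0) = (u g != 0).
Proof. by case: s; rewrite ?mul1r // mulN1r scoefN oppr_eq0. Qed.

Variables (n : int) (N : strong_PN_structure F Gam n).
Local Notation dob kl e := (@doubly_orthogonal_basis F R Gam (Stilde_pair N kl) e).
Local Notation rhoS k x := (@PN_rho _ _ _ _ N k (PN_S N k x)).
Local Notation dualS l kl x := (dual_norm (@PN_rho _ _ _ _ N l) (Stilde kl x)).

Lemma rhoS_fin k l (x : PN_H N k) (lk : l + k = n)
    (y : PN_H N l) : PN_D N lk y x != 0 -> rhoS k x \is a fin_num.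
Proof.
move=> yx; have [_ rhoN rho0 _ _] := PN_normed N k.
rewrite fin_numE rhoN andbT; apply: contra_neq yx => /rho0 Sx0.
have := Stilde_S lk y x; rewrite Sx0 linear0 => /esym/eqP.
by rewrite to_up_eq0 => /eqP.
Qed.

Lemma dualS_le k l (kl : k + l = n) (x : PN_H N k) (y : PN_H N l) (g : R) :
  (PN_D N kl x y : L) g != 0 -> (dualS l kl x <= g%:E + rhoS l y)%E.
Proof. by move=> xy; apply: dual_norm_le; rewrite Stilde_S. Qed.

Lemma fin_num_between (x : \bar R) (g g' c : R) : (c%:E <= x - g'%:E)%E ->
  (x <= g%:E + c%:E)%E -> x \is a fin_num.
Proof. by case: x. Qed.

(** The norms of two doubly-orthogonal bases in complementary degrees match in
pairs: b_i - a'_(s i) = a_i - b'_(s i) lies in [Gamma]. *)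
Lemma norm_duality k l (kl : k + l = n) (lk : l + k = n)
    (e : seq (PN_H N k)) (f : seq (PN_H N l)) : dob kl e -> dob lk f ->
  exists2 s : 'I_(size e) -> 'I_(size f), bijective s &
    forall i : 'I_(size e),
      fine (dualS l kl e`_i) - fine (rhoS l f`_(s i)) \in Gam /\
      fine (dualS l kl e`_i) - fine (rhoS l f`_(s i)) =
        fine (rhoS k e`_i) - fine (dualS k lk f`_(s i)).
Proof.
move=> ob obf; have [K1 [K1P K1s]] := pairing_left_inverse ob obf.
have [K2 [K2P K2s]] := pairing_left_inverse obf ob.
have [sg sgP] := PN_D_sym N lk kl.
pose G := \matrix_(i < size e, j < size f) PN_D N kl e`_i f`_j : 'M[L]_(_, _).
pose K := \matrix_(j < size f, i < size e) conjL (K1 j i).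
pose K' := \matrix_(j < size f, i < size e) ((-1) ^+ sg * K2 i j).
have KG : K *m G = 1%:M.
  apply/matrixP => j m; rewrite !mxE -(K1P j m).
  by apply: eq_bigr => i _; rewrite !mxE.
have GK' : G *m K' = 1%:M.
  apply/matrixP => m i; rewrite !mxE eq_sym -[RHS](conjLK).
  rewrite [conjL (i == m)%:R](_ : _ = (i == m)%:R); last first.
    by case: (i == m); rewrite ?rmorph1 ?rmorph0.
  rewrite -(K2P i m) rmorph_sum; apply: eq_bigr => j _.
  rewrite rmorphM /= conjLK sgP rmorphM /= rmorph_sign conjLK !mxE.
  by rewrite mulrA mulrC [K2 i j * _]mulrC.
(* K bounds the exponents of the inverse of G from below and K' bounds them
   from above. *)
have KK' : K = K' by rewrite -[K]mulmx1 -GK' mulmxA KG mul1mx.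
have GK : G *m K = 1%:M by rewrite KK'.
have suppG i j g : G i j g != 0 ->
    (dualS l kl e`_i <= g%:E + rhoS l f`_j)%E /\
    (dualS k lk f`_j <= (- g)%:E + rhoS k e`_i)%E.
  rewrite mxE => Gg; split; first exact: dualS_le.
  by apply: dualS_le; rewrite sgP coef_signM /= opprK.
have suppK j i g : K j i g != 0 ->
    (rhoS l f`_j <= dualS l kl e`_i - (- g)%:E)%E /\
    (rhoS k e`_i <= dualS k lk f`_j - g%:E)%E.
  move=> Kg; split; first by apply: K1s; move: Kg; rewrite mxE.
  by apply: K2s; move: Kg; rewrite KK' mxE coef_signM.
have Dsym i j : G i j != 0 -> PN_D N lk f`_j e`_i != 0.
  move=> /series_neq0[g Gg]; apply/eqP => D0; have := sgP f`_j e`_i.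
  rewrite D0 => /(congr1 (fun u : L => u (- g) != 0)); rewrite /= coef_signM.
  by rewrite /= opprK eqxx; move: Gg; rewrite mxE => ->.
have aF (i : 'I_(size e)) : rhoS k e`_i \is a fin_num.
  by have [j /Dsym Dij _] := mulmx1_neq0 i GK; exact: rhoS_fin Dij.
have a'F (j : 'I_(size f)) : rhoS l f`_j \is a fin_num.
  have [i _ Gij] := mulmx1_neq0 j KG.
  by apply: (@rhoS_fin l k _ kl e`_i); move: Gij; rewrite mxE.
have bF (i : 'I_(size e)) : dualS l kl e`_i \is a fin_num.
  have [j /series_neq0[g /suppG[Gg _]] /series_neq0[g' /suppK[Kg' _]]] :=
    mulmx1_neq0 i GK.
  by apply: (@fin_num_between _ g (- g') (fine (rhoS l f`_j))); rewrite fineK.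
have b'F (j : 'I_(size f)) : dualS k lk f`_j \is a fin_num.
  have [i /series_neq0[g' /suppK[_ Kg']] /series_neq0[g /suppG[_ Gg]]] :=
    mulmx1_neq0 j KG.
  by apply: (@fin_num_between _ (- g) g' (fine (rhoS k e`_i))); rewrite fineK.
apply: (support_matching GK KG (a := fun i => fine (rhoS k e`_i))
  (b := fun i => fine (dualS l kl e`_i)) (a' := fun j => fine (rhoS l f`_j))
  (b' := fun j => fine (dualS k lk f`_j))).
- move=> i j g /suppG[]; rewrite -(fineK (aF i)) -(fineK (bF i)).
  by rewrite -(fineK (a'F j)) -(fineK (b'F j)) -!EFinD !lee_fin /=; lra.
- move=> j i g /suppK[]; rewrite -(fineK (aF i)) -(fineK (bF i)).
  by rewrite -(fineK (a'F j)) -(fineK (b'F j)) -!EFinB !lee_fin /=; lra.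
Qed.

End Matching.

(** * Duality of the spectra *)

Section Spectrum.
Variables (F : fieldType) (R : realType) (Gam : zmodClosed R).
Variables (n : int) (N : strong_PN_structure F Gam n).
Local Notation dob kl e := (@doubly_orthogonal_basis F R Gam (Stilde_pair N kl) e).

Lemma pi_RmodG (x y : R) :
  \pi_(RmodG Gam) x = \pi_(RmodG Gam) y <-> x - y \in Gam.
Proof. by rewrite (rwP eqP) -[_ == _](Quotient.idealrBE Gam). Qed.

(** The multisets [Sigma(P_k)] and [Sigma(P_l)] correspond under
([a], ell) |-> ([a + ell], - ell). *)
Lemma spectrum_of_duality k l (kl : k + l = n) (lk : l + k = n)
    (e : seq (PN_H N k)) (f : seq (PN_H N l)) : dob kl e -> dob lk f ->
  let p := in_tuple (@spectrum_of F R Gam (Stilde_pair N kl) e) in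
  let q := in_tuple (@spectrum_of F R Gam (Stilde_pair N lk) f) in
  exists2 s : 'I_(size p) -> 'I_(size q), bijective s &
    forall i, (tnth q (s i)).1 =
        \pi_(RmodG Gam) (repr (tnth p i).1 + (tnth p i).2) /\
      (tnth q (s i)).2 = - (tnth p i).2.
Proof.
move=> ob obf p q; have [s sbij sP] := norm_duality ob obf.
have se : size p = size e by rewrite size_map.
have sf : size q = size f by rewrite size_map.
exists (fun i => cast_ord (esym sf) (s (cast_ord se i))) => [|i].
  apply: (bij_comp (f := cast_ord (esym sf))).
    by exists (cast_ord sf); [exact: cast_ordKV|exact: cast_ordK].
  apply: (bij_comp sbij).
  by exists (cast_ord (esym se)); [exact: cast_ordK|exact: cast_ordKV].
have [] := sP (cast_ord se i); set j := s _.
rewrite !(tnth_nth (\pi_(RmodG Gam) 0, 0)) /= !(nth_map 0) ?ltn_ord //; last first.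
  by rewrite -se.
move=> bG /eqP; rewrite subr_eq -addrA addrCA -subr_eq => /eqP eqab.
split => /=.
  apply/pi_RmodG; rewrite -rpredN.
  set a := fine (PN_rho (PN_S N k _)).
  have : repr (\pi_(RmodG Gam) a) - a \in Gam by apply/pi_RmodG; rewrite reprK.
  move=> aG; have := rpredD bG aG; congr (_ \in Gam); rewrite /a /=; lra.
by rewrite /=; lra.
Qed.

Lemma basis_spectrum_duality
    (N_dob : forall k : int,
       exists e : seq (mpH (PN_pair N k)), doubly_orthogonal_basis e)
    k l (kl : k + l = n) :
  let p := in_tuple (basis_spectrum (PN_pair N k)) in
  let q := in_tuple (basis_spectrum (PN_pair N l)) in
  exists2 s : 'I_(size p) -> 'I_(size q), bijective s &
    forall i, (tnth q (s i)).1 =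
        \pi_(RmodG Gam) (repr (tnth p i).1 + (tnth p i).2) /\
      (tnth q (s i)).2 = - (tnth p i).2.
Proof.
have lk : l + k = n by rewrite addrC.
have := N_dob k; have := N_dob l; rewrite -(Stilde_pairE N kl) -(Stilde_pairE N lk).
by move=> /(xgetPex [::]) obf /(xgetPex [::]) ob; exact: spectrum_of_duality ob obf.
Qed.

End Spectrum.

(** * Classes of intervals up to translation *)

Section Intervals.
Variables (R : realType) (Gam : zmodClosed R).
Implicit Types a b c d g : R.

Lemma itv_class_id (I : set R) : itv_class Gam I I.
Proof.
exists 0; first exact: rpred0.
by apply/seteqP; split => [_ [x Ix <-]|x Ix]; [rewrite addr0|exists x; rewrite ?addr0].
Qed.

Lemma translate_cc a b g : [set x + g | x in `[a, b]] = `[a + g, b + g]%classic.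
Proof.
apply/seteqP; split => [_ [x /= + <-]|x /=]; rewrite !in_itv /=.
  by move=> ?; lra.
by move=> abx; exists (x - g); rewrite ?subrK //= in_itv /=; lra.
Qed.

Lemma translate_oo a b g : [set x + g | x in `]a, b[] = `]a + g, b + g[%classic.
Proof.
apply/seteqP; split => [_ [x /= + <-]|x /=]; rewrite !in_itv /=.
  by move=> ?; lra.
by move=> abx; exists (x - g); rewrite ?subrK //= in_itv /=; lra.
Qed.

Lemma itv_class_shift (I J : set R) g : g \in Gam -> J = [set x + g | x in I] ->
  itv_class Gam I = itv_class Gam J.
Proof.
move=> gG ->; apply/seteqP; split => _ [h hG <-].
  exists (h - g); first exact: rpredB.
  apply/seteqP; split => [_ [_ [x Ix <-] <-]|_ [x Ix <-]].
    by exists x => //; lra.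
  by exists (x + g); [exists x|lra].
exists (g + h); first exact: rpredD.
apply/seteqP; split => [_ [x Ix <-]|_ [_ [x Ix <-] <-]].
  by exists (x + g); [exists x|rewrite addrA].
by exists x => //; rewrite addrA.
Qed.

Lemma itv_class_cc a b c d : c - a \in Gam -> d - b = c - a ->
  itv_class Gam `[a, b] = itv_class Gam `[c, d].
Proof.
by move=> gG e; apply: (itv_class_shift gG); rewrite translate_cc -{2}e !subrKC.
Qed.

Lemma itv_class_oo a b c d : c - a \in Gam -> d - b = c - a ->
  itv_class Gam `]a, b[ = itv_class Gam `]c, d[.
Proof.
by move=> gG e; apply: (itv_class_shift gG); rewrite translate_oo -{2}e !subrKC.
Qed.

Lemma itv_class_cc_inj a b c d : a <= b ->
  itv_class Gam `[c, d] = itv_class Gam `[a, b] ->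
  a - c \in Gam /\ b - d = a - c.
Proof.
move=> ab e; have := itv_class_id `[a, b]; rewrite -e => -[g gG].
rewrite translate_cc => /seteqP[sub1 sub2].
have := sub2 a; have := sub2 b; have := sub1 (c + g); have := sub1 (d + g).
rewrite /= !in_itv /= !lexx ab /= => h1 h2 /(_ isT) /andP[h3 h4] /(_ isT) /andP[h5 h6].
have cd : c + g <= d + g by lra.
rewrite cd !andbT /= in h1 h2.
move/andP: (h1 isT) => [? ?]; move/andP: (h2 isT) => [? ?].
have ac : a - c = g by lra.
by rewrite ac; split => //; lra.
Qed.

Lemma itv_class_oo_inj a b c d : a < b ->
  itv_class Gam `]c, d[ = itv_class Gam `]a, b[ ->
  a - c \in Gam /\ b - d = a - c.
Proof.
move=> ab e; have := itv_class_id `]a, b[; rewrite -e => -[g gG].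
rewrite translate_oo => /seteqP[sub1 sub2].
have sub3 x : a < x < b -> c + g < x < d + g.
  by move=> ?; have := sub2 x; rewrite /= !in_itv; exact.
have sub4 x : c + g < x < d + g -> a < x < b.
  by move=> ?; have := sub1 x; rewrite /= !in_itv; exact.
(* If two corresponding endpoints differed, their midpoint would lie in exactly
   one of the two intervals. *)
have := sub3 ((a + b) / 2) ltac:(lra) => mid.
have ac : c + g = a.
  have [ca|ac|//] := ltgtP (c + g) a.
    by have := sub4 ((c + g + a) / 2) ltac:(lra); lra.
  by have := sub3 ((c + g + a) / 2) ltac:(lra); lra.
have bd : d + g = b.
  have [ca|bd|//] := ltgtP (d + g) b.
    by have := sub3 ((d + g + b) / 2) ltac:(lra); lra.
  by have := sub4 ((d + g + b) / 2) ltac:(lra); lra.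
by rewrite -ac -bd [c + g]addrC addrK; split => //; lra.
Qed.

Lemma itv_class_cc_neq_oo a b c d : a <= b ->
  itv_class Gam `[a, b] <> itv_class Gam `]c, d[.
Proof.
move=> ab e; have := itv_class_id `[a, b]; rewrite e => -[g gG].
rewrite translate_oo => /seteqP[sub1 sub2].
have := sub2 a; rewrite /= !in_itv /= lexx ab => /(_ isT) ca.
(* The midpoint of the left endpoints lies in the open interval, but to the left
   of the closed one. *)
have := sub1 ((c + g + a) / 2); rewrite /= !in_itv /=.
by move=> /(_ ltac:(lra)); lra.
Qed.

End Intervals.

(** * Bars as positions in the spectra *)

Section Bars.

Lemma inj_surj_bij (T W : Type) (f : T -> W) : injective f ->
  (forall y, exists x, f x = y) -> bijective f.
Proof. by move=> fI /choice[g gK]; exists g => // x; apply: fI; rewrite gK. Qed.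

(** If each list [r k] enumerates without repetition the fibre of [deg] over
[k], then [T] is in bijection with the disjoint union of the index types of the
lists [B k] of labels. *)
Lemma positions_of_fibres (T : eqType) (W : Type) (deg : T -> int) (itv : T -> W)
    (r : int -> seq T) (B : int -> seq W) :
  (forall k, B k = [seq itv t | t <- r k]) -> (forall k, uniq (r k)) ->
  (forall k t, (t \in r k) = (deg t == k)) ->
  exists2 psi : {k : int & 'I_(size (B k))} -> T, bijective psi &
    forall x, tag x = deg (psi x) /\
      tnth (in_tuple (B (tag x))) (tagged x) = itv (psi x).
Proof.
move=> BE rU rM; have sz k : size (B k) = size (r k) by rewrite BE size_map.
pose psi (x : {k : int & 'I_(size (B k))}) :=
  tnth (in_tuple (r (tag x))) (cast_ord (sz _) (tagged x)).
have psiD x : tag x = deg (psi x).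
  by apply/esym/eqP; rewrite -rM; exact: mem_tnth.
exists psi => [|x]; last first.
  split=> //; rewrite (tnth_nth (itv (psi x))) /=.
  have -> m : nth (itv (psi x)) (B (tag x)) m =
      nth (itv (psi x)) [seq itv t | t <- r (tag x)] m by rewrite BE.
  by rewrite (nth_map (psi x)) -?sz // [in RHS]/psi (tnth_nth (psi x)).
apply: inj_surj_bij => [x y xy|t].
  have := psiD x; rewrite xy -psiD; case: x y xy => k i [l j] /= xy kl.
  subst l; congr existT; move: xy; rewrite /psi /= => /tuple_uniqP xy.
  have /xy/cast_ord_inj // : uniq (in_tuple (r k)) by exact: rU.
have tr : t \in r (deg t) by rewrite rM.
have ti : (index t (r (deg t)) < size (B (deg t)))%N by rewrite sz index_mem.
exists (Tagged (fun k => 'I_(size (B k))) (Ordinal ti)).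
by rewrite /psi (tnth_nth t) /= nth_index.
Qed.

Variables (F : fieldType) (R : realType) (Gam : zmodClosed R).
Variables (n : int) (N : strong_PN_structure F Gam n).

(** An element of the disjoint union over [m] of the basis spectra, with
multiplicities: a degree and a position in the spectrum of that degree. *)
Definition spectrum_pos := {m : int & 'I_(size (basis_spectrum (PN_pair N m)))}.

Definition pos_val (t : spectrum_pos) : RmodG Gam * R :=
  tnth (in_tuple (basis_spectrum (PN_pair N (tag t)))) (tagged t).

(** The degree and the interval class of the bar that a spectrum element
contributes. *)
Definition pos_deg (t : spectrum_pos) : int :=
  if 0 <= (pos_val t).2 then tag t else tag t - 1.

Definition pos_itv (t : spectrum_pos) : set (set R) :=
  let p := pos_val t in
  if 0 <= p.2 then itv_class Gam `[repr p.1, repr p.1 + p.2]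
  else itv_class Gam `]repr p.1 + p.2, repr p.1[.

Lemma bars_positions : exists2 psi : bars N -> spectrum_pos, bijective psi &
  forall x, bar_deg x = pos_deg (psi x) /\ bar_itv x = pos_itv (psi x).
Proof.
pose T := fun m : int => 'I_(size (basis_spectrum (PN_pair N m))).
pose r0 k := [seq (Tagged T j : spectrum_pos) | j <- enum (T k)].
pose r k := [seq t <- r0 k | 0 <= (pos_val t).2]
         ++ [seq t <- r0 (k + 1) | (pos_val t).2 < 0].
have r0M k t : (t \in r0 k) = (tag t == k).
  apply/mapP/eqP => [[j _ ->//]|]; case: t => m j /= mk; subst m.
  by exists j; rewrite ?mem_enum.
have r0V k : [seq pos_val t | t <- r0 k] = basis_spectrum (PN_pair N k).
  by rewrite -map_comp; exact: (map_tnth_enum (in_tuple _)).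
apply: (@positions_of_fibres _ _ pos_deg pos_itv r) => [k|k|k t].
- rewrite /barcode -!r0V map_cat; congr (_ ++ _);
    rewrite filter_map -map_comp; apply/eq_in_map => t;
    rewrite mem_filter /pos_itv => /andP[].
    by rewrite /preim /= => ->.
  by rewrite /preim /= ltNge => /negbTE ->.
- have r0U m : uniq (r0 m) by rewrite map_inj_uniq ?enum_uniq //; exact: existT_inj2.
  rewrite cat_uniq !filter_uniq //= andbT; apply/hasPn => t.
  by rewrite !mem_filter ltNge => /andP[/negbTE ->].
- rewrite mem_cat !mem_filter !r0M /pos_deg ltNge.
  by case: (0 <= (pos_val t).2); rewrite /= ?orbF // subr_eq.
Qed.

Lemma pos_duality
    (N_dob : forall k : int,
       exists e : seq (mpH (PN_pair N k)), doubly_orthogonal_basis e) :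
  exists2 tau : spectrum_pos -> spectrum_pos, bijective tau &
    forall t, [/\ tag (tau t) = n - tag t,
      (pos_val (tau t)).1 = \pi_(RmodG Gam) (repr (pos_val t).1 + (pos_val t).2) &
      (pos_val (tau t)).2 = - (pos_val t).2].
Proof.
have := fun k => basis_spectrum_duality N_dob (subrK_deg n k).
move=> /(_ _)/cid2-/all_sig2[s sB sP].
pose T := fun m : int => 'I_(size (basis_spectrum (PN_pair N m))).
pose tau (t : spectrum_pos) : spectrum_pos := Tagged T (s _ (tagged t)).
exists tau => [|t]; last by have [] := sP _ (tagged t).
apply: inj_surj_bij => [[k i] [l j] ij|[k i]].
  have := congr1 (fun t => n - tag t) ij; rewrite /= !subKr => kl; subst l.
  congr existT; apply: (bij_inj (sB k)); exact: (existT_inj2 ij).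
have [m mk] : exists m, k = n - m by exists (n - k); rewrite subKr.
subst k; have [g _ sK] := sB m.
by exists (Tagged T (g i)); rewrite /tau /= sK.
Qed.

End Bars.

Theorem corollary6p10 (F : fieldType) (R : realType) (Gam : zmodClosed R)
  (Gam_fg : fg_subgroup Gam) (n : int) (N : strong_PN_structure F Gam n)
  (N_dob : forall k : int,
     exists e : seq (mpH (PN_pair N k)), doubly_orthogonal_basis e) :
  exists s : bars N -> bars N, bijective s /\
    forall x : bars N,
      [/\ forall a b : R, a < b -> bar_itv x = itv_class Gam `[a, b] ->
            bar_deg (s x) = n - 1 - bar_deg x /\
            bar_itv (s x) = itv_class Gam `]a, b[,
          forall a b : R, a < b -> bar_itv x = itv_class Gam `]a, b[ ->
            bar_deg (s x) = n - 1 - bar_deg x /\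
            bar_itv (s x) = itv_class Gam `[a, b] &
          forall a : R, bar_itv x = itv_class Gam `[a, a] ->
            bar_deg (s x) = n - bar_deg x /\
            bar_itv (s x) = itv_class Gam `[a, a]].
Proof.
have [psi psiB psiP] := bars_positions N.
have [tau tauB tauP] := pos_duality N_dob.
have [phi psiK phiK] := psiB.
exists (phi \o tau \o psi); split.
  by apply: bij_comp psiB; apply: bij_comp tauB; exists psi.
move=> x.
have [-> ->] := psiP (phi (tau (psi x))); rewrite phiK.
have [-> ->] := psiP x; have [] := tauP (psi x); set t := psi x.
rewrite /pos_deg /pos_itv => -> -> ->.
set l := (pos_val t).2; set c := repr (pos_val t).1.
set c' := repr (\pi_(RmodG Gam) (c + l)); rewrite oppr_ge0.
have c'P : c' - (c + l) \in Gam by apply/pi_RmodG; rewrite reprK.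
clearbody c'; clearbody l c.
(* The second coordinate of the spectrum element is l and that of its partner
   is - l; the degree of a bar drops by one when this coordinate is negative. *)
split=> [a b ab|a b ab|a]; have [l0|l0] := leP 0 l.
- move=> /(itv_class_cc_inj (ltW ab))[acG bd].
  have -> : (l <= 0) = false by lra.
  split; first by rewrite addrAC.
  apply: itv_class_oo; last lra.
  by have := rpredB acG c'P; congr (_ \in Gam); lra.
- by move=> e; case: (itv_class_cc_neq_oo (ltW ab) (esym e)).
- move=> e; have cl : c <= c + l by lra.
  by case: (itv_class_cc_neq_oo cl e).
- move=> /(itv_class_oo_inj ab)[acG bd].
  rewrite (ltW l0); split; first by rewrite opprB addrA subrK.
  apply: itv_class_cc; last lra.
  by have := rpredB acG c'P; congr (_ \in Gam); lra.
- move=> /(itv_class_cc_inj (lexx a))[acG bd].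
  have -> : l <= 0 by lra.
  split=> //.
  apply: itv_class_cc; last lra.
  by have := rpredB acG c'P; congr (_ \in Gam); lra.
- by move=> e; case: (itv_class_cc_neq_oo (lexx a) (esym e)).
Qed.
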